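(* For any $\epsilon\in(0,T)$, the sequence of paths $\widehat{A^{n,\epsilon}}=(\widehat{A^{n,\epsilon}_t})_{t\in[0,T]}$ converges almost surely, as $n\to\infty$, to $(\widehat{w^\epsilon_t})_{t\in[0,T]}$ in $\mathbb C([0,T]:(\widehat{\mathcal S}_0,\delta_\square))$, where $A^{n,\epsilon}=\mathrm{Av}^\epsilon(H^n)$, $w=\beta^+/(\beta^++\beta^-)$ and $w^\epsilon=\mathrm{Av}^\epsilon(w)$.
   Context: Fix $T\in(0,\infty)$; write $[0,1]^2_T=[0,1]^2\times[0,T]$ and $[n]=\{1,\dots,n\}$. All $L^p$ spaces are with respect to Lebesgue measure. Let $Q^n_1=[0,1/n]$, $Q^n_i=((i-1)/n,i/n]$ for $2\le i\le n$, and $Q^n_{i,j}=Q^n_i\times Q^n_j$. Rates. $\beta^+,\beta^-:[0,1]^2\times[0,T]\to[0,\infty)$ are measurable, with $\beta^\pm_t(x,y)=\beta^\pm(x,y,t)$. For each $n$ and $i,j\in[n]$, $\beta^{n,\pm}_{i,j}:[0,T]\to[0,\infty)$ are measurable and $\beta^{n,\pm}_t(x,y)=\beta^{n,\pm}(x,y,t)=\sum_{i,j=1}^n\beta^{n,\pm}_{i,j}(t)\mathbf 1_{Q^n_{i,j}}(x,y)$. Standing assumptions: (a) $\beta^{n,\pm},\beta^\pm\in L^1([0,1]^2_T)$ and $\beta^{n,\pm}\to\beta^\pm$ in $L^1([0,1]^2_T)$; (b) there is $c_\beta>0$ with $\beta^{n,\pm}_{i,j}(t)\ge c_\beta$ for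 all $n\ge1$, $i,j\in[n]$, $t\in[0,T]$; (c) $t\mapsto\beta^\pm_t(x,y)$ is bounded and left-continuous for a.e. $(x,y)\in[0,1]^2$, and $t\mapsto\beta^{n,\pm}_{i,j}(t)$ is bounded and left-continuous for all $i,j\in[n]$ and all large enough $n$. Graph process. $a(n)\in(0,\infty)$ with $a(n)\to\infty$. For each $n$, $\{X^n_{i,j}(t):t\in[0,T]\}_{i,j\in[n]}$ are $n^2$ mutually independent (càdlàg) Markov chains on $\{0,1\}$, with deterministic initial values $X^n_{i,j}(0)=x^n_{i,j}\in\{0,1\}$, jumping at time $t$ from $0$ to $1$ at rate $a(n)\beta^{n,+}_{i,j}(t)$ and from $1$ to $0$ at rate $a(n)\beta^{n,-}_{i,j}(t)$; all are defined on one probability space $(\Omega,\mathcal F,\mathbb P)$. Put $H^n(x,y,t)=H^n_t(x,y)=\sum_{i,j=1}^nX^n_{i,j}(t)\mathbf 1_{Q^n_{i,j}}(x,y)$. $\mathcal W_0$ is the set of measurable $\phi:[0,1]^2\times[0,T]\to\mathbb R$ with $0\le\phi\le1$ a.e., $\phi_s=\phi(\cdot,\cdot,s)$. For $\epsilon\in(0,T)$ and $\phi\in\mathcal W_0$, $\mathrm{Av}^\epsilon(\phi)_t=\frac1{|U_\epsilon(t)|}\int_{U_\epsilon(t)}\phi_s\,ds$, $t\in[0,T]$, where $U_\epsilon(t)=[t-\epsilon,t+\epsilon]\cap[0,T]$ and $|U_\epsilon(t)|$ is its length. Cut metric. $\mathcal S_0$ is the set of measurable $f:[0,1]^2\to\mathbb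 R$ with $0\le f\le1$ a.e.; $d_\square(f,g)=\sup_{A,B\subseteq[0,1]\text{ measurable}}|\int_{A\times B}(f-g)|$. Let $\mathscr S$ be the group of measure-preserving bijections of $[0,1]$ and $f^\sigma(x,y)=f(\sigma(x),\sigma(y))$. Write $f\sim g$ iff $\inf_{\sigma\in\mathscr S}d_\square(f,g^\sigma)=0$; $\widehat f$ is the equivalence class of $f$, $\widehat{\mathcal S}_0$ the set of classes, with metric $\delta_\square(\widehat f,\widehat g)=\inf_{f'\in\widehat f,g'\in\widehat g}d_\square(f',g')$. $\mathbb C([0,T]:S)$ is the space of continuous paths in a metric space $S$ with the topology of uniform convergence. *)

(* Defs.v *)
From HB Require Import structures.
From mathcomp Require Import all_boot all_order all_algebra.
From mathcomp Require Import all_classical all_reals all_analysis.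

Set Implicit Arguments.
Unset Strict Implicit.
Unset Printing Implicit Defensive.

Import Order.TTheory GRing.Theory Num.Theory.
Import numFieldNormedType.Exports.

Local Open Scope classical_set_scope.
Local Open Scope ring_scope.

(* The real line carries its Borel sigma-algebra, and a point (x, y, t) is      *)
(* encoded as ((x, y), t).  A function on [0,1]^2 or on [0,1]^2 x [0,T] is a    *)
(* total function on the whole space of which only the restriction to that set  *)
(* matters.                                                                     *)

Section domains.
Variable R : realType.

Definition leb1 : {measure set (measurableTypeR R) -> \bar R} :=
  @lebesgue_measure R.
Definition leb2 := (leb1 \x leb1)%E.
Definition leb3 := (leb2 \x leb1)%E.

Definition square : set (measurableTypeR R * measurableTypeR R) :=
  `[0, 1] `*` `[0, 1].

Definition cylinder (T : R) :
    set (measurableTypeR R * measurableTypeR R * measurableTypeR R) :=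
  square `*` `[0, T].

(* Left limits are only taken at positive times: left-continuity at 0 is void.  *)
Definition left_cont_on (T : R) (f : R -> R) : Prop :=
  forall t, t \in `]0, T] -> f s @[s --> t^'-] --> f t.

Definition bounded_left_cont (T : R) (f : R -> R) : Prop :=
  [bounded f t | t in `[0, T]] /\ left_cont_on T f.

(* Indices are 0-based: i : 'I_n stands for the index i + 1 of [n].             *)
Definition cell (n : nat) (i : 'I_n) : set R :=
  if i == 0%N :> nat then `[0, n%:R^-1]%classic
  else `]i%:R / n%:R, i.+1%:R / n%:R]%classic.

Definition step_kernel (n : nat) (c : 'I_n -> 'I_n -> R) (xy : R * R) : R :=
  \sum_(i < n) \sum_(j < n) c i j * \1_(cell i `*` cell j) xy.

Definition window (T eps t : R) : set R := `[t - eps, t + eps] `&` `[0, T].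

Definition Av (T eps : R) (phi : R * R * R -> R) (t : R) (xy : R * R) : R :=
  (fine (leb1 (window T eps t)))^-1 *
  \int[leb1]_(s in window T eps t) phi (xy, s).

End domains.

Arguments leb1 R : clear implicits.
Arguments leb2 R : clear implicits.
Arguments leb3 R : clear implicits.
Arguments square R : clear implicits.

Section cut_metric.
Variable R : realType.
Implicit Types f g : R * R -> R.

Definition S0 : set (R * R -> R) := [set f : R * R -> R |
  measurable_fun (square R) f /\
  {ae leb2 R, forall z, square R z -> 0 <= f z <= 1}].

Definition cut_dist f g : R := sup [set r | exists A B : set (measurableTypeR R),
  [/\ measurable A, measurable B, A `<=` `[0, 1], B `<=` `[0, 1] &
      r = `|\int[leb2 R]_(z in A `*` B) (f z - g z)|]].

(* Bijections of [0,1], measurable in both directions, preserving leb1.         *)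
Definition mp_bijection : set (R -> R) := [set s : R -> R |
  [/\ set_bij (`[0, 1] : set R) `[0, 1] s,
      measurable_fun (`[0, 1] : set R) s,
      (forall A : set R, measurable A -> A `<=` `[0, 1] -> measurable (s @` A)) &
      forall A : set R, measurable A -> A `<=` `[0, 1] ->
        leb1 R (`[0, 1] `&` s @^-1` A) = leb1 R A]].

Definition relabel f (s : R -> R) (xy : R * R) : R := f (s xy.1, s xy.2).

(* The relation ~ on S0; it does not hold outside S0. *)
Definition cut_equiv f g : Prop :=
  [/\ S0 f, S0 g &
      inf [set r | exists2 s, mp_bijection s & r = cut_dist f (relabel g s)] = 0].

Definition hat f : set (R * R -> R) := [set g | cut_equiv f g].

Definition S0hat : set (set (R * R -> R)) := [set hat f | f in S0].

Definition cut_metric (F G : set (R * R -> R)) : R :=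
  inf [set r | exists f g, [/\ F f, G g & r = cut_dist f g]].

(* Continuous paths from [0,T] to the metric space (S, dist), where S is a      *)
(* subset of E and the metric is the restriction of dist to S.                  *)
Definition C_paths (E : Type) (S : set E) (dist : E -> E -> R) (T : R) :
    set (R -> E) := [set p |
  (forall t, t \in `[0, T] -> S (p t)) /\
  forall t, t \in `[0, T] -> forall e, 0 < e ->
    exists2 r, 0 < r & forall s, s \in `[0, T] -> `|s - t| < r ->
      dist (p s) (p t) < e].

Definition unif_cvg (E : Type) (dist : E -> E -> R) (T : R)
    (p_ : nat -> R -> E) (p : R -> E) : Prop :=
  forall e, 0 < e -> \forall n \near \oo,
    forall t, t \in `[0, T] -> dist (p_ n t) (p t) < e.

End cut_metric.

Section markov_chains.
Context {R : realType} {d : measure_display} {Omega : measurableType d}.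
Variable P : probability Omega R.

Definition cadlag (T : R) (x : R -> bool) : Prop :=
  (forall t, t \in `[0, T[ -> x s @[s --> t^'+] --> x t) /\
  (forall t, t \in `]0, T] -> cvg (x s @[s --> t^'-])).

(* The sigma-algebra generated by the variables X(t), t in D. *)
Definition process_events (X : Omega -> R -> bool) (D : set R) :
    set (set Omega) :=
  <<s [set E | exists2 t, D t & E = [set w | X w t]] >>.

(* Rate of leaving state k at time u: up from 0 = false, down from 1 = true.    *)
Definition exit_rate (up down : R -> R) (k : bool) (u : R) : R :=
  if k then down u else up u.

(* Transition probabilities p s t k l from state k at time s to state l at time *)
(* t, given by Kolmogorov's forward equation in integral form (the rates being  *)
(* only measurable in time):                                                    *)
(*   d/dt p s t k l = p s t k (~~ l) * (rate ~~ l -> l) - p s t k l * (rate l -> ~~ l). *)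
Definition transition_probabilities (T : R) (up down : R -> R)
    (p : R -> R -> bool -> bool -> R) : Prop :=
  [/\ forall s t, 0 <= s -> s <= t -> t <= T ->
        forall k, (forall l, 0 <= p s t k l) /\ p s t k false + p s t k true = 1,
      forall s, s \in `[0, T] ->
        forall k l, measurable_fun (`[s, T] : set R) (fun t => p s t k l) &
      forall s t, 0 <= s -> s <= t -> t <= T -> forall k l,
        p s t k l = (k == l)%:R +
          \int[leb1 R]_(u in `[s, t])
            (p s u k (~~ l) * exit_rate up down (~~ l) u -
             p s u k l * exit_rate up down l u)].

(* A cadlag time-inhomogeneous Markov chain on {0,1} started at x0; the Markov  *)
(* property P(X(t) = l | X(u), u <= s) = p s t X(s) l is with respect to the    *)
(* natural filtration, and integrated over its events.                          *)
Definition markov_chain (T : R) (x0 : bool) (up down : R -> R)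
    (X : Omega -> R -> bool) : Prop :=
  [/\ forall t, t \in `[0, T] -> measurable [set w | X w t],
      forall w, cadlag T (X w),
      forall w, X w 0 = x0 &
      exists2 p, transition_probabilities T up down p &
        forall s t, 0 <= s -> s <= t -> t <= T ->
        forall G, process_events X `[0, s] G -> forall k l,
          P (G `&` [set w | X w s = k] `&` [set w | X w t = l]) =
          (P (G `&` [set w | X w s = k]) * (p s t k l)%:E)%E].

(* Mutual independence of the sigma-algebras generated by the X i on [0,T]. *)
Definition independent_processes (I : finType) (T : R)
    (X : I -> Omega -> R -> bool) : Prop :=
  forall (J : {set I}) (E : I -> set Omega),
    (forall i, i \in J -> process_events (X i) `[0, T] (E i)) ->
    P (\bigcap_(i in [set` J]) E i) = (\prod_(i in J) P (E i))%E.

End markov_chains.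

Section graph_process.
Context {R : realType} {Omega : Type}.

Definition graph_rate (n : nat) (b : 'I_n -> 'I_n -> R -> R)
    (z : R * R * R) : R :=
  step_kernel (fun i j => b i j z.2) z.1.

Definition graph_process (n : nat) (X : 'I_n -> 'I_n -> Omega -> R -> bool)
    (w : Omega) (z : R * R * R) : R :=
  step_kernel (fun i j => (X i j w z.2)%:R) z.1.

Definition equilibrium (bp bm : R * R * R -> R) (z : R * R * R) : R :=
  bp z / (bp z + bm z).

End graph_process.

(* Main.v *)
(* Fix t.  The n^2 time averages of the X^n_{i,j} over U_eps(t) are independent *)
(* and [0,1]-valued.  The cut norm of a step kernel is attained at unions of    *)
(* cells, so Hoeffding's inequality, a union bound over 4^n pairs of index sets *)
(* and Borel-Cantelli replace H^n by its mean q^n, almost surely in d_cut.      *)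
(*   The mean solves q' = a(n) (beta^{n,+} (1 - q) - beta^{n,-} q), and so the  *)
(* integral of beta^{n,+} (1 - q^n) - beta^{n,-} q^n over A x B x I is at most  *)
(* 1 / a(n) for every interval I.  Since beta^{n,+-} -> beta^+- in L^1, with    *)
(* g = beta^+ + beta^- this gives int_{A x B x U_eps(t)} 1_E g (w - q^n) -> 0   *)
(* uniformly in A and B for boxes E, then for all measurable E by Dynkin's      *)
(* theorem, and then with the weight 1_E g replaced by 1, because 1 / g is a    *)
(* limit of simple functions and g > 0 almost everywhere.                       *)
(*   Finally t |-> Av^eps(phi)_t is (4 / eps)-Lipschitz for every [0,1]-valued  *)
(* phi, which upgrades convergence on finite grids of times to uniform          *)
(* convergence.                                                                 *)
Require Import Defs.
From HB Require Import structures.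
From mathcomp Require Import all_boot all_order all_algebra.
From mathcomp Require Import all_classical all_reals all_analysis.
From mathcomp Require Import measurable_realfun.
From mathcomp Require Import ring lra.
Set Implicit Arguments.
Unset Strict Implicit.
Unset Printing Implicit Defensive.
Import Order.TTheory GRing.Theory Num.Theory.
Import numFieldNormedType.Exports.
Local Open Scope classical_set_scope.
Local Open Scope ring_scope.

(** [H^n] is compared with the deterministic kernel q^n of its means, and q^n with w. Both
    comparisons are made in the cut distance after averaging over a window, and they rest on
    different mechanisms.

    Randomness disappears through independence in space, whatever the speed of the chains. A cut
    test of an n-by-n step kernel reduces to 4^n pairs of index sets ([bilinear_le],
    [cut_le_step_kernel]), while a fixed pair deviates with probability at most exp(-c n^2)
    ([hoeffding_finite]). The union bound is therefore summable ([cut_norm_deviation],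
    [ae_cut_norm_cvg], [ae_cut_le_mean]).

    The speed a(n) acts on the means. Over any time interval a mean moves by at most 1, yet its
    derivative is a(n) times the imbalance beta^{n,+} (1 - q^n) - beta^{n,-} q^n, so the imbalance
    has integrals of order 1 / a(n) ([window_ray_flow]). Convergence of the rates replaces it by g
    (w - q^n) with g = beta^+ + beta^- ([box_bound]). The weight g is then removed: the weights for
    which such integrals vanish form an L^1-closed space, which contains every product of g with an
    indicator and hence the constant 1 ([uniformly_null1]). This gives [mean_field_cvg].

    Windows have length at least eps, so averages of [0,1]-valued paths are Lipschitz in time with a
    common constant ([average_lip]), and countably many times suffice ([unif_cvg_of_grid]). Passing
    to classes does not increase the distance ([cut_metric_hat_le]). *)

(** * Sigma-finite products and bounds for real-valued integrals *)

Section product_sigma_finite.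
Local Open Scope ereal_scope.
Context d1 d2 (T1 : measurableType d1) (T2 : measurableType d2) (R : realType).
Variable m1 : {sigma_finite_measure set T1 -> \bar R}.
Variable m2 : {sigma_finite_measure set T2 -> \bar R}.

(** The products of [F n] and [G n], for increasing exhaustions [F] and [G], exhaust the product
    space. The result lets [leb2] be the left factor of [leb3] in Fubini's theorem. *)
Lemma product_measure1_sigma_finite : sigma_finite setT (m1 \x m2).
Proof.
have /sigma_finiteP[F [TF ndF Ffin]] := sigma_finiteT m1.
have /sigma_finiteP[G [TG ndG Gfin]] := sigma_finiteT m2.
exists (fun n => F n `*` G n) => [|n].
  apply/esym; rewrite -subTset => -[x y] _.
  have [i _ Fix] : (\bigcup_i F i) x by rewrite -TF.
  have [j _ Gjy] : (\bigcup_i G i) y by rewrite -TG.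
  exists (maxn i j) => //; split => /=.
    by move: x Fix; apply/subsetPset/ndF; rewrite leq_maxl.
  by move: y Gjy; apply/subsetPset/ndG; rewrite leq_maxr.
have [mF Fn] := Ffin n; have [mG Gn] := Gfin n.
split; first exact: measurableX.
by rewrite product_measure1E// lte_mul_pinfty// ge0_fin_numE.
Qed.

(* The library's sigma-finite instance on [m1 \x m2] is only inferred for     *)
(* subprobabilities, hence the explicit package.                              *)
Definition sigma_finite_product :
    {sigma_finite_measure set (T1 * T2)%type -> \bar R} :=
  HB.pack_for (sigma_finite_measure (T1 * T2)%type R) (m1 \x m2)
    (Measure_isSigmaFinite.Build _ _ _ (m1 \x m2)
      product_measure1_sigma_finite).

End product_sigma_finite.


Section Rintegral_bounds.
Context d (Z : measurableType d) (R : realType).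
Variable mu : {measure set Z -> \bar R}.

Lemma integrable_bounded (D : set Z) (f : Z -> R) (M : R) :
  measurable D -> (mu D < +oo)%E -> measurable_fun D f ->
  (forall x, D x -> `|f x| <= M) -> mu.-integrable D (EFin \o f).
Proof.
move=> mD Dfin mf fM; apply: measurable_bounded_integrable => //.
exists M; split; first exact: num_real.
by move=> r Mr x Dx; apply: le_trans (fM x Dx) _; exact: ltW.
Qed.

Lemma normr_Rintegral_le_dominated (D : set Z) (f g : Z -> R) :
  measurable D -> measurable_fun D f -> mu.-integrable D (EFin \o g) ->
  (forall x, D x -> `|f x| <= g x) ->
  `|\int[mu]_(x in D) f x| <= \int[mu]_(x in D) g x.
Proof.
move=> mD mf ig fg.
have intf : mu.-integrable D (EFin \o f).
  apply: le_integrable ig => //; first exact/measurable_EFinP.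
  move=> x Dx /=; rewrite lee_fin (le_trans (fg x Dx))//.
  exact: ler_norm.
apply: (le_trans (le_normr_Rintegral mD intf)).
by apply: le_Rintegral => //; exact: integrable_norm.
Qed.

Lemma normr_Rintegral_le (D : set Z) (f : Z -> R) (M : R) :
  measurable D -> (mu D < +oo)%E -> measurable_fun D f ->
  (forall x, D x -> `|f x| <= M) ->
  `|\int[mu]_(x in D) f x| <= M * fine (mu D).
Proof.
move=> mD Dfin mf fM; rewrite -(Rintegral_cst mu mD).
apply: normr_Rintegral_le_dominated => //.
by apply: (@integrable_bounded _ _ `|M|) => // x _.
Qed.

End Rintegral_bounds.

Section Rintegral_monotone.
Context d (Z : measurableType d) (R : realType).
Variable mu : {measure set Z -> \bar R}.

Lemma ge0_le_Rintegral_subset (A D : set Z) (f : Z -> R) :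
  measurable A -> measurable D -> A `<=` D ->
  mu.-integrable D (EFin \o f) -> (forall z, D z -> 0 <= f z) ->
  \int[mu]_(z in A) f z <= \int[mu]_(z in D) f z.
Proof.
move=> mA mD AD iD f0; have iA := integrableS mD mA AD iD.
rewrite /Rintegral fine_le//.
- exact: integrable_fin_num iA.
- exact: integrable_fin_num iD.
by apply: ge0_subset_integral => //; exact: measurable_int iD.
Qed.

Lemma integrable_mul_le1 (D : set Z) (f k : Z -> R) : measurable D ->
  mu.-integrable D (EFin \o f) -> measurable_fun D k ->
  (forall z, D z -> `|k z| <= 1) ->
  mu.-integrable D (EFin \o (fun z => f z * k z)).
Proof.
move=> mD fi mk k1; apply: le_integrable (fi) => //.
  apply/measurable_EFinP/measurable_funM => //.
  by have /measurable_EFinP := measurable_int _ fi.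
by move=> z Dz /=; rewrite lee_fin normrM ler_piMr// k1.
Qed.

End Rintegral_monotone.

Section Rintegral_sum.
Context d (Z : measurableType d) (R : realType).
Variables (mu : {measure set Z -> \bar R}) (D : set Z) (mD : measurable D).
Variables (I : Type) (f : I -> Z -> R).
Hypothesis intf : forall i, mu.-integrable D (EFin \o f i).

Lemma integrable_sum_EFin (s : seq I) :
  mu.-integrable D (EFin \o (fun z => \sum_(i <- s) f i z)).
Proof.
elim: s => [|i s IH].
  apply: (eq_integrable _ (cst 0%E)) => //; last exact: integrable0.
  by move=> z _; rewrite /= big_nil.
have iD := integrableD mD (intf i) IH.
by apply: (eq_integrable mD _ _ _ iD) => z _; rewrite /= big_cons.
Qed.

Lemma Rintegral_sum (s : seq I) :
  \int[mu]_(z in D) (\sum_(i <- s) f i z) =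
  \sum_(i <- s) \int[mu]_(z in D) f i z.
Proof.
elim: s => [|i s IH].
  rewrite big_nil (@eq_Rintegral _ _ _ _ _ (fun=> 0)).
    by rewrite Rintegral_cst// mul0r.
  by move=> z _; rewrite big_nil.
rewrite big_cons -IH -RintegralD//; last exact: integrable_sum_EFin.
by apply: eq_Rintegral => z _; rewrite big_cons.
Qed.

End Rintegral_sum.

(** * The cut distance *)

Section cut_distance.
Variable R : realType.
Local Notation M := (measurableTypeR R).
Implicit Types f g h : R * R -> R.

Lemma measurable_square : measurable (square R).
Proof. by apply: measurableX. Qed.

Lemma leb2_square : leb2 R (square R) = 1%E.
Proof.
rewrite /leb2 /square product_measure1E//=.
by rewrite /leb1 lebesgue_measure_itv/= lte_fin ltr01 oppr0 adde0 mule1.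
Qed.

(** A bound on all tests, safer than [cut_dist f g <= e]: the supremum of an unbounded set is 0 by
    default, so the latter says nothing by itself about the tests. *)
Definition cut_le f g (e : R) := forall A B : set M,
  measurable A -> measurable B -> A `<=` `[0, 1] -> B `<=` `[0, 1] ->
  `|\int[leb2 R]_(z in A `*` B) (f z - g z)| <= e.

(** A form of [S0] whose bounds hold at every point of the square; all kernels compared below have
    it. *)
Definition unit_kernel f :=
  measurable_fun (square R) f /\ forall z, square R z -> 0 <= f z <= 1.

Lemma unit_kernel_S0 f : unit_kernel f -> S0 f.
Proof. by move=> [mf f01]; split => //; exact: aeW. Qed.

Lemma subset_square (A B : set M) :
  A `<=` `[0, 1] -> B `<=` `[0, 1] -> A `*` B `<=` square R.
Proof. by move=> A1 B1 [x y] [/= /A1 ? /B1 ?]; split. Qed.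

Lemma leb2_rect_le1 (A B : set M) : measurable A -> measurable B ->
  A `<=` `[0, 1] -> B `<=` `[0, 1] -> (leb2 R (A `*` B) <= 1)%E.
Proof.
move=> mA mB A1 B1; rewrite -leb2_square; apply: le_measure; rewrite ?inE.
- exact: measurableX.
- exact: measurable_square.
- exact: subset_square.
Qed.

Lemma cut_dist_ge0 f g : 0 <= cut_dist f g.
Proof.
rewrite /cut_dist; set E := [set r | _].
have E0 r : E r -> 0 <= r by move=> [A [B [_ _ _ _ ->]]].
(* If the tests are unbounded, [sup] takes its default value 0. *)
have [supE|supE] := pselect (has_sup E); last by rewrite sup_out.
have [r Er] := supE.1.
by rewrite (le_trans (E0 _ Er))// sup_upper_bound.
Qed.

Lemma cut_dist_le f g e : cut_le f g e -> cut_dist f g <= e.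
Proof.
move=> fge; apply: ge_sup.
  exists `|\int[leb2 R]_(z in set0 `*` set0) (f z - g z)|; exists set0, set0.
  by split.
by move=> _ [A [B [mA mB A1 B1 ->]]]; exact: fge.
Qed.

Lemma cut_distxx f : cut_dist f f = 0.
Proof.
apply/eqP; rewrite eq_le cut_dist_ge0 andbT; apply: cut_dist_le => A B mA mB _ _.
rewrite (@eq_Rintegral _ _ _ _ _ (fun=> 0)); last by move=> z _; rewrite subrr.
by rewrite Rintegral_cst ?mul0r ?normr0//; exact: measurableX.
Qed.

Lemma mp_bijection_id : mp_bijection (@id R).
Proof.
split => //.
- split; [by []| by [] | by move=> x x01; exists x].
- by move=> A mA _; rewrite image_id.
- by move=> A mA A1; rewrite preimage_id setIidr.
Qed.

(** The identity relabelling attains the infimum 0. *)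
Lemma hat_self f : S0 f -> hat f f.
Proof.
move=> Sf; split => //; apply/eqP; rewrite eq_le; apply/andP; split; last first.
  apply: lb_le_inf => [|_ [s _ ->]]; last exact: cut_dist_ge0.
  by exists (cut_dist f (relabel f id)), id => //; exact: mp_bijection_id.
rewrite -(cut_distxx f); apply: ge_inf; last first.
  by exists id; [exact: mp_bijection_id|congr cut_dist; apply/funext => -[]].
by exists 0 => _ [s _ ->]; exact: cut_dist_ge0.
Qed.

(** The metric on classes is an infimum over representatives, and [f], [g] represent their own
    classes. All later estimates can thus be made without relabelling. *)
Lemma cut_metric_hat_le f g e : S0 f -> S0 g -> cut_le f g e ->
  cut_metric (hat f) (hat g) <= e.
Proof.
move=> Sf Sg /cut_dist_le; apply: le_trans; apply: ge_inf.
  by exists 0 => _ [? [? [_ _ ->]]]; exact: cut_dist_ge0.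
by exists f, g; split => //; exact: hat_self.
Qed.

Lemma integrable_unit_kernel f (D : set (M * M)) : unit_kernel f ->
  measurable D -> D `<=` square R -> (leb2 R).-integrable D (EFin \o f).
Proof.
move=> [mf f01] mD Dsq; apply: (@integrableS _ _ _ _ (square R)) => //.
  exact: measurable_square.
apply: (@integrable_bounded _ _ _ _ _ _ 1) => //.
- exact: measurable_square.
- by apply: (@le_lt_trans _ _ 1%E); [rewrite -leb2_square|rewrite ltry].
- by move=> z /f01 /andP[f0 f1]; rewrite ger0_norm.
Qed.

Lemma cut_le_trans f g h e1 e2 : unit_kernel f -> unit_kernel g ->
  unit_kernel h -> cut_le f g e1 -> cut_le g h e2 -> cut_le f h (e1 + e2).
Proof.
move=> uf ug uh fg gh A B mA mB A1 B1.
have mAB : measurable (A `*` B) by exact: measurableX.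
have ABsq := subset_square A1 B1.
have I k : unit_kernel k -> (leb2 R).-integrable (A `*` B) (EFin \o k).
  by move=> uk; exact: integrable_unit_kernel.
have -> : \int[leb2 R]_(z in A `*` B) (f z - h z) =
    \int[leb2 R]_(z in A `*` B) (f z - g z) +
    \int[leb2 R]_(z in A `*` B) (g z - h z).
  by rewrite !RintegralB ?addrA ?subrK//; exact: I.
by rewrite (le_trans (ler_normD _ _))// lerD// ?fg// gh.
Qed.

Lemma cut_le_sup f g e : unit_kernel f -> unit_kernel g -> 0 <= e ->
  (forall z, square R z -> `|f z - g z| <= e) -> cut_le f g e.
Proof.
move=> uf ug e0 fge A B mA mB A1 B1.
have mAB : measurable (A `*` B) by exact: measurableX.
have ABsq := subset_square A1 B1.
have AB1 := leb2_rect_le1 mA mB A1 B1.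
apply: (@le_trans _ _ (e * fine (leb2 R (A `*` B)))).
  apply: normr_Rintegral_le => //.
  - by rewrite (le_lt_trans AB1)// ltry.
  - by apply: (measurable_funS measurable_square) => //;
      apply: measurable_funB; [exact: uf.1|exact: ug.1].
  - by move=> z /ABsq; exact: fge.
rewrite ler_piMr// -(@fine1 R) fine_le// ge0_fin_numE//.
by rewrite (le_lt_trans AB1)// ltry.
Qed.

End cut_distance.

(** * Fubini and Tonelli on rectangles *)

Section Rintegral_fubini.
Context d1 d2 (T1 : measurableType d1) (T2 : measurableType d2) (R : realType).
Variable m1 : {sigma_finite_measure set T1 -> \bar R}.
Variable m2 : {sigma_finite_measure set T2 -> \bar R}.

Lemma patch_section (D : set T1) (W : set T2) (f : T1 * T2 -> \bar R) x y :
  (f \_ (D `*` W)) (x, y) =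
  (if x \in D then ((fun y => f (x, y)) \_ W) y else 0)%E.
Proof.
rewrite !patchE; have -> : ((x, y) \in D `*` W) = (x \in D) && (y \in W).
  by apply/idP/andP; rewrite !inE => -[].
by case: ifPn => [/andP[-> ->]//|]; case: (x \in D) => //= /negPf ->.
Qed.

(** Extension by zero outside the rectangle reduces this to Fubini's theorem on the whole space. *)
Lemma integral_fubini_setX (D : set T1) (W : set T2) (f : T1 * T2 -> \bar R) :
  measurable D -> measurable W ->
  (m1 \x m2)%E.-integrable (D `*` W) f ->
  (\int[m1 \x m2]_(z in D `*` W) f z =
   \int[m1]_(x in D) \int[m2]_(y in W) f (x, y))%E.
Proof.
move=> mD mW intf; have mDW : measurable (D `*` W) by exact: measurableX.
have intg : (m1 \x m2)%E.-integrable setT (f \_ (D `*` W)).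
  exact/(integrable_mkcond _ mDW).
rewrite integral_mkcond -(integral12_prod_meas1 intg).
rewrite [RHS]integral_mkcond; apply: eq_integral => x _.
rewrite /fubini_F patchE; case: ifPn => xD.
  rewrite [RHS]integral_mkcond; apply: eq_integral => y _.
  by rewrite patch_section xD.
by rewrite integral0_eq// => y _; rewrite patch_section (negPf xD).
Qed.

Lemma integrable_fubini_setX (D : set T1) (W : set T2) (f : T1 * T2 -> \bar R) :
  measurable D -> measurable W ->
  (m1 \x m2)%E.-integrable (D `*` W) f ->
  m1.-integrable D (fun x => \int[m2]_(y in W) f (x, y))%E.
Proof.
move=> mD mW intf; have mDW : measurable (D `*` W) by exact: measurableX.
have intg : (m1 \x m2)%E.-integrable setT (f \_ (D `*` W)).
  exact/(integrable_mkcond _ mDW).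
apply/(integrable_mkcond _ mD); have := integrable_fubini_F intg.
apply: eq_integrable => // x _; rewrite /fubini_F patchE; case: ifPn => xD.
  rewrite [RHS]integral_mkcond; apply: eq_integral => y _.
  by rewrite patch_section xD.
by rewrite integral0_eq// => y _; rewrite patch_section (negPf xD).
Qed.

Lemma Rintegral_fubini (D : set T1) (W : set T2) (f : T1 * T2 -> R) :
  measurable D -> measurable W ->
  (m1 \x m2)%E.-integrable (D `*` W) (EFin \o f) ->
  \int[(m1 \x m2)%E]_(z in D `*` W) f z =
  \int[m1]_(x in D) \int[m2]_(y in W) f (x, y).
Proof.
move=> mD mW intf; have mDW : measurable (D `*` W) by exact: measurableX.
rewrite /Rintegral (integral_fubini_setX mD mW intf).
have intF := integrable_fubini_setX mD mW intf.
have mF := measurable_int _ intF.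
(* The inner integrals are finite almost everywhere; on the remaining null set [fine] may return its
   default value 0. *)
congr fine; apply: ae_eq_integral => //.
  apply/measurable_EFinP.
  exact: measurableT_comp.
have [N [mN N0 FN]] := integrable_ae mD intF.
exists N; split => // x /= /not_implyP[Dx Fx]; apply: FN => /= /(_ Dx) fFx.
by apply: Fx; rewrite fineK.
Qed.

Lemma measurable_fun_Rintegral_section (D : set T1) (W : set T2)
    (f : T1 * T2 -> R) : measurable D -> measurable W ->
  measurable_fun (D `*` W) f -> (forall z, (D `*` W) z -> 0 <= f z) ->
  measurable_fun D (fun x => \int[m2]_(y in W) f (x, y)).
Proof.
move=> mD mW mf f0; have mDW : measurable (D `*` W) by exact: measurableX.
pose g := (EFin \o f) \_ (D `*` W).
have mg : measurable_fun setT g.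
  by apply/(measurable_restrictT _ mDW)/measurable_EFinP.
have g0 z : (0 <= g z)%E.
  by rewrite /g patchE; case: ifPn => // /set_mem zDW; rewrite lee_fin f0.
have := @measurable_fun_fubini_tonelli_F _ _ _ _ _ m2 g mg g0.
move=> /(measurable_funTS (D := D)) mF.
apply: (eq_measurable_fun (fine \o fubini_F m2 g)).
  move=> x xD; rewrite /Rintegral /= /fubini_F [in RHS]integral_mkcond.
  by congr fine; apply: eq_integral => y _; rewrite /g patch_section xD.
exact: measurableT_comp.
Qed.

End Rintegral_fubini.

(** * Averages over windows *)

Section averages.
Variables (R : realType) (T eps : R).
Hypotheses (eps0 : 0 < eps) (epsT : eps < T).
Local Notation M := (measurableTypeR R).
Implicit Types s t u v : R.

Lemma leb1_itv (i : interval R) :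
  leb1 R [set` i] = (if (i.1 < i.2)%E then (i.2 - i.1)%E else 0%E).
Proof. exact: lebesgue_measure_itv. Qed.

Let T0 : 0 < T. Proof. exact: lt_trans epsT. Qed.

Let lo t : R := Num.max (t - eps) 0.
Let hi t : R := Num.min (t + eps) T.

Lemma windowE t : window T eps t = `[lo t, hi t]%classic.
Proof.
apply/seteqP; split => s; rewrite /window/= !in_itv/= ge_max le_min.
  by move=> [/andP[-> ->] /andP[-> ->]].
by move=> /andP[/andP[-> ->] /andP[-> ->]].
Qed.

Lemma measurable_window t : measurable (window T eps t : set M).
Proof. by rewrite windowE. Qed.

Lemma window_sub t : window T eps t `<=` `[0, T].
Proof. by move=> s []. Qed.

(** A window cut on one side keeps its other half, and a window cut on both sides is all of [0,T],
    with T > eps. *)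
Let lohi t : t \in `[0, T] -> eps <= hi t - lo t.
Proof.
rewrite in_itv/= => /andP[t0 tT]; rewrite /hi /lo; move: eps0 epsT.
by case: (leP (t + eps) T); case: (leP (t - eps) 0) => *; lra.
Qed.

Lemma leb1_window t : t \in `[0, T] ->
  leb1 R (window T eps t) = (hi t - lo t)%:E.
Proof.
move=> /lohi tlen; rewrite windowE leb1_itv/= lte_fin.
by rewrite ifT// -subr_gt0 (lt_le_trans eps0).
Qed.

Lemma window_length t : t \in `[0, T] -> eps <= fine (leb1 R (window T eps t)).
Proof. by move=> tT; rewrite leb1_window//= lohi. Qed.

Section unit_interval_valued.
Variable h : R -> R.
Hypothesis mh : measurable_fun (`[0, T] : set M) h.
Hypothesis h01 : forall s, s \in `[0, T] -> 0 <= h s <= 1.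

Lemma integrable_unit (D : set M) : measurable D -> D `<=` `[0, T] ->
  (leb1 R).-integrable D (EFin \o h).
Proof.
move=> mD DT; apply: (@integrableS _ _ _ _ (`[0, T]%classic : set M)) => //.
apply: (@integrable_bounded _ _ _ _ _ _ 1) => //.
  by rewrite leb1_itv/= lte_fin T0 -EFinB ltry.
by move=> s sT; have /andP[s0 s1] := h01 sT; rewrite ger0_norm.
Qed.

Lemma Rintegral_unit_le (D : set M) : measurable D -> D `<=` `[0, T] ->
  0 <= \int[leb1 R]_(s in D) h s <= fine (leb1 R D).
Proof.
move=> mD DT; apply/andP; split.
  by apply: Rintegral_ge0 => s /DT sT; have /andP[] := h01 sT.
rewrite -[leRHS]mul1r -(Rintegral_cst _ mD); apply: le_Rintegral => //.
- exact: integrable_unit.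
- apply: (@integrable_bounded _ _ _ _ _ _ 1) => //; last by rewrite normr1.
  apply: (@le_lt_trans _ _ (leb1 R `[0, T]%classic)).
    by apply: le_measure; rewrite ?inE.
  by rewrite leb1_itv/= lte_fin T0 -EFinB ltry.
- by move=> s /DT sT; have /andP[] := h01 sT.
Qed.

Let primitive u := \int[leb1 R]_(s in `[0, u]) h s.

Let primitive_lip u v : u \in `[0, T] -> v \in `[0, T] ->
  `|primitive u - primitive v| <= `|u - v|.
Proof.
wlog : u v / v <= u => [H uT vT|].
  have [vu|/ltW uv] := leP v u; first exact: H.
  by rewrite distrC [leRHS]distrC; exact: H.
move=> vu uT vT; move: (uT) (vT); rewrite !in_itv/= => /andP[u0 u1] /andP[v0 v1].
have sub : `]v, u]%classic `<=` (`[0, T]%classic : set R).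
  move=> s /=; rewrite !in_itv/= => /andP[vs su].
  by rewrite (le_trans su)// andbT ltW// (le_lt_trans v0).
rewrite /primitive Rintegral_itvB ?bnd_simp//; last first.
  apply: integrable_unit => // s /=; rewrite !in_itv/= => /andP[-> su].
  exact: le_trans u1.
have /andP[I0 I1] := Rintegral_unit_le (measurable_itv _) sub.
rewrite [leLHS]ger0_norm// (le_trans I1)// leb1_itv/= lte_fin.
by rewrite ger0_norm ?subr_ge0//; case: ifPn => //= _; rewrite subr_ge0.
Qed.

Let window_primitive t : t \in `[0, T] ->
  \int[leb1 R]_(s in window T eps t) h s = primitive (hi t) - primitive (lo t).
Proof.
move=> tT; rewrite windowE /primitive; have tl := lohi tT.
have lohit : lo t <= hi t by rewrite -subr_ge0 (le_trans (ltW eps0)).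
have lo0 : 0 <= lo t by rewrite le_max lexx orbT.
have hiT : hi t <= T by rewrite ge_min lexx orbT.
rewrite Rintegral_itvB ?bnd_simp//.
- rewrite Rintegral_itv_obnd_cbnd//; apply: integrable_unit => // s /=.
  rewrite !in_itv/= => /andP[ls sh].
  by rewrite (le_trans sh)// andbT ltW// (le_lt_trans lo0).
- apply: integrable_unit => // s /=; rewrite !in_itv/= => /andP[-> sh].
  exact: le_trans hiT.
Qed.

(** The endpoints of the window are 1-Lipschitz in time and the primitive of [h] is 1-Lipschitz.
    Over the common denominator, the window length at [t], the difference is the change of the
    integral plus the change of length times the average at [s]. Each is at most 2 |t - s|, the
    average lying in [0,1], and the denominator is at least eps. *)
Lemma average_lip t s : t \in `[0, T] -> s \in `[0, T] ->
  `|(fine (leb1 R (window T eps t)))^-1 * \int[leb1 R]_(u in window T eps t) h u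
   - (fine (leb1 R (window T eps s)))^-1 * \int[leb1 R]_(u in window T eps s) h u|
  <= 4 / eps * `|t - s|.
Proof.
have := eps0; have := T0.
move=> T_gt0 eps_gt0 tT sT; have lt := window_length tT; have ls := window_length sT.
have := Rintegral_unit_le (measurable_window s) (@window_sub s).
have loT u : u \in `[0, T] -> lo u \in `[0, T].
  by rewrite !in_itv/= le_max lexx orbT/= => /andP[? ?];
    rewrite ge_max; apply/andP; split; lra.
have hiT u : u \in `[0, T] -> hi u \in `[0, T].
  rewrite !in_itv/= ge_min lexx orbT andbT le_min => /andP[? ?].
  by apply/andP; split; lra.
have := primitive_lip (hiT t tT) (hiT s sT).
have := primitive_lip (loT t tT) (loT s sT).
rewrite !window_primitive// !leb1_window//=.
move: lt ls; rewrite !leb1_window//=.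
have lolip : `|lo t - lo s| <= `|t - s|.
  rewrite /lo; case: (leP (t - eps) 0); case: (leP (s - eps) 0) => *;
  rewrite ler_norml; case: (lerP s t) => *; apply/andP; split; lra.
have hilip : `|hi t - hi s| <= `|t - s|.
  rewrite /hi; case: (leP (t + eps) T); case: (leP (s + eps) T) => *;
  rewrite ler_norml; case: (lerP s t) => *; apply/andP; split; lra.
move: lolip hilip; move: (`|t - s| : R) => e lolip hilip.
set p := hi t; set q := lo t; set p' := hi s; set q' := lo s.
rewrite -/p -/q -/p' -/q' in lolip hilip *.
move: (primitive p) (primitive q) (primitive p') (primitive q').
move=> P Q P' Q' lt ls HQ HP /andP[I0 I1].
have HP' := le_trans HP hilip; have HQ' := le_trans HQ lolip.
have l0 : 0 < p - q by exact: lt_le_trans lt.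
have l0' : 0 < p' - q' by exact: lt_le_trans ls.
have -> : (p - q)^-1 * (P - Q) - (p' - q')^-1 * (P' - Q') =
   ((P - P') - (Q - Q') +
    (P' - Q') / (p' - q') * ((p' - p) - (q' - q))) / (p - q).
  by field; rewrite !gt_eqF.
rewrite normrM (@ger0_norm _ (p - q)^-1) ?invr_ge0 ?(ltW l0)//.
have r01 : 0 <= (P' - Q') / (p' - q') <= 1.
  by rewrite divr_ge0 ?(ltW l0')//= ler_pdivrMr// mul1r.
move: r01; move: ((P' - Q') / (p' - q')) => r /andP[r0 r1].
have num : `|P - P' - (Q - Q') + r * (p' - p - (q' - q))| <= 4 * e.
  have : `|r * (p' - p - (q' - q))| <= 2 * e.
    rewrite normrM (ger0_norm r0) (@le_trans _ _ `|p' - p - (q' - q)|)//.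
      by rewrite ler_piMl.
    move: lolip hilip; rewrite !ler_norml => /andP[? ?] /andP[? ?].
    by apply/andP; split; lra.
  move: HP' HQ'; rewrite !ler_norml => /andP[? ?] /andP[? ?] /andP[? ?].
  by apply/andP; split; lra.
have e0 : 0 <= e by have := le_trans (normr_ge0 _) num; lra.
have -> : 4 / eps * e = 4 * e / eps by rewrite mulrAC.
by rewrite ler_pM ?invr_ge0 ?(ltW l0)// lef_pV2 ?posrE.
Qed.

End unit_interval_valued.

Definition unit_path (phi : R * R * R -> R) :=
  measurable_fun (cylinder T) phi /\ forall z, cylinder T z -> 0 <= phi z <= 1.

Variable phi : R * R * R -> R.
Hypothesis uphi : unit_path phi.

Lemma measurable_cylinder : measurable (cylinder T).
Proof. by apply: measurableX => //; exact: measurable_square. Qed.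

Lemma unit_path_section xy : square R xy ->
  measurable_fun (`[0, T] : set M) (fun s => phi (xy, s)) /\
  forall s, s \in `[0, T] -> 0 <= phi (xy, s) <= 1.
Proof.
move=> sq; split=> [|s sT]; last exact: uphi.2.
apply: (measurable_comp (F := cylinder T) measurable_cylinder) => //.
- by move=> _ [s sT <-].
- exact: uphi.1.
- exact/measurable_funTS/pair1_measurable.
Qed.

Lemma Av_unit_kernel t : t \in `[0, T] -> unit_kernel (Av T eps phi t).
Proof.
move=> tT; split=> [|xy sq].
  apply: measurable_funM => //.
  apply: measurable_fun_Rintegral_section => //.
  - exact: measurable_square.
  - exact: measurable_window.
  - apply: (measurable_funS measurable_cylinder) => [|]; last exact: uphi.1.
    by move=> [xy s] [/= ? /window_sub ?].
  - move=> [xy s] [/= sq /window_sub sT].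
    by have [_ /(_ _ sT)/andP[]] := unit_path_section sq.
have [mh h01] := unit_path_section sq.
have /andP[I0 I1] := Rintegral_unit_le mh h01 (measurable_window t) (@window_sub t).
have l0 : 0 < fine (leb1 R (window T eps t)).
  exact: lt_le_trans (window_length tT).
rewrite /Av; apply/andP; split; first by rewrite mulr_ge0// invr_ge0 ltW.
by rewrite mulrC ler_pdivrMr// mul1r.
Qed.

Lemma Av_lip t s xy : t \in `[0, T] -> s \in `[0, T] -> square R xy ->
  `|Av T eps phi t xy - Av T eps phi s xy| <= 4 / eps * `|t - s|.
Proof.
by move=> tT sT /unit_path_section[mh h01]; exact: average_lip.
Qed.

Lemma cut_le_Av t s : t \in `[0, T] -> s \in `[0, T] ->
  cut_le (Av T eps phi t) (Av T eps phi s) (4 / eps * `|t - s|).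
Proof.
move=> tT sT; apply: cut_le_sup; try exact: Av_unit_kernel.
  by rewrite mulr_ge0// divr_ge0// ltW.
by move=> z sq; exact: Av_lip.
Qed.

End averages.

Section averages_in_the_cut_metric.
Variables (R : realType) (T eps : R).
Hypotheses (eps0 : 0 < eps) (epsT : eps < T).
Local Notation M := (measurableTypeR R).
Implicit Types s t : R.

Let T0 : 0 < T. Proof. exact: lt_trans epsT. Qed.

Lemma leb3_setX (D : set (M * M)) (W : set M) : measurable D -> measurable W ->
  leb3 R (D `*` W) = (leb2 R D * leb1 R W)%E.
Proof. exact: (@product_measure1E _ _ _ _ R (leb2 R) (leb1 R)). Qed.

Lemma leb3_subcylinder_fin (D : set (M * M * M)) : measurable D ->
  D `<=` cylinder T -> (leb3 R D < +oo)%E.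
Proof.
move=> mD DT; apply: (@le_lt_trans _ _ (leb3 R (cylinder T))).
  by apply: le_measure; rewrite ?inE//; exact: measurable_cylinder.
rewrite leb3_setX//; last exact: measurable_square.
by rewrite (_ : leb2 R (square R) = 1%E) ?leb2_square// mul1e leb1_itv/= lte_fin T0 -EFinB ltry.
Qed.

Variable phi : R * R * R -> R.
Hypothesis uphi : unit_path T phi.

Lemma integrable_unit_path (D : set (M * M * M)) : measurable D ->
  D `<=` cylinder T -> (leb3 R).-integrable D (EFin \o phi).
Proof.
move=> mD DT; apply: (@integrable_bounded _ _ _ _ _ _ 1) => //.
- exact: leb3_subcylinder_fin.
- by apply: (measurable_funS (measurable_cylinder T) DT); exact: uphi.1.
- by move=> z /DT /uphi.2 /andP[z0 z1]; rewrite ger0_norm.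
Qed.

Lemma C_paths_Av :
  C_paths (@S0hat R) (@cut_metric R) T (fun t => hat (Av T eps phi t)).
Proof.
split=> [t tT|t tT e e0].
  by exists (Av T eps phi t) => //; exact/unit_kernel_S0/Av_unit_kernel.
(* The Lipschitz constant 4 / eps turns this radius into 4 e / 5 < e. *)
exists (e * eps / 5) => [|s sT st]; first by rewrite divr_gt0// mulr_gt0.
apply: (le_lt_trans (cut_metric_hat_le _ _ (cut_le_Av eps0 epsT uphi sT tT))).
- exact/unit_kernel_S0/Av_unit_kernel.
- exact/unit_kernel_S0/Av_unit_kernel.
- rewrite mulrAC ltr_pdivrMr//; have := normr_ge0 (s - t).
  by move: st; move: `|s - t| => r; have := mulr_gt0 e0 eps0; lra.
Qed.

(** By Fubini, a cut test of an average is a space-time integral up to the window length; in that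
    form the equation of the means applies. *)
Lemma Rintegral_Av (A B : set M) t : t \in `[0, T] ->
  measurable A -> measurable B -> A `<=` `[0, 1] -> B `<=` `[0, 1] ->
  fine (leb1 R (window T eps t)) *
    \int[leb2 R]_(z in A `*` B) Av T eps phi t z =
  \int[leb3 R]_(z in (A `*` B) `*` window T eps t) phi z.
Proof.
move=> tT mA mB A1 B1; have mAB : measurable (A `*` B) by exact: measurableX.
have mW := measurable_window T eps t.
have mABW : measurable ((A `*` B) `*` window T eps t) by exact: measurableX.
have sub : (A `*` B) `*` window T eps t `<=` cylinder T.
  by move=> [xy s] [/= /(subset_square A1 B1)? /window_sub ?].
have iphi := integrable_unit_path mABW sub.
have fub := @Rintegral_fubini _ _ _ _ R (sigma_finite_product (leb1 R) (leb1 R))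
  (leb1 R) _ _ phi mAB mW iphi.
rewrite [RHS]fub -RintegralZl//.
  apply: eq_Rintegral => z _; rewrite /Av mulrA divff ?mul1r//.
  by rewrite gt_eqF// (lt_le_trans eps0)// window_length.
by apply: integrable_unit_kernel => //; [exact: Av_unit_kernel|
  exact: subset_square].
Qed.

End averages_in_the_cut_metric.

(** * Changing the density in uniform weak limits *)

Section uniform_weak_convergence.
Context d (Z : measurableType d) (R : realType).
Variable mu : {measure set Z -> \bar R}.

Lemma dominated_cvg_Rintegral0 (D : set Z) (f : nat -> Z -> R) (G : Z -> R) :
  measurable D -> (forall k, measurable_fun D (f k)) ->
  mu.-integrable D (EFin \o G) -> (forall k x, D x -> `|f k x| <= G x) ->
  (forall x, D x -> f ^~ x @ \oo --> (0 : R)) ->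
  \int[mu]_(x in D) `|f k x| @[k --> \oo] --> (0 : R).
Proof.
move=> mD mf iG fG f0.
pose g k := EFin \o (fun x => `|f k x|).
have mg k : measurable_fun D (g k).
  by apply/measurable_EFinP; exact: measurableT_comp.
have g0 : {ae mu, forall x, D x -> g ^~ x @ \oo --> 0%E}.
  apply: aeW => x Dx; apply: cvg_EFin; first exact: nearW.
  by rewrite -(@normr0 _ R); apply: cvg_norm; exact: f0.
have gG : {ae mu, forall x k, D x -> (`|g k x| <= (EFin \o G) x)%E}.
  by apply: aeW => x k Dx; rewrite /= lee_fin normr_id fG.
have [_ _] := dominated_convergence mD mg (measurable_cst _) g0 iG gG.
by rewrite integral0 => /fine_cvg.
Qed.

Variables (D : set Z) (I : Type) (B : I -> set Z) (u : nat -> Z -> R).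
Hypothesis mD : measurable D.
Hypothesis mB : forall i, measurable (B i).
Hypothesis BD : forall i, B i `<=` D.
Hypothesis measurable_u : forall n, measurable_fun D (u n).
Hypothesis u1 : forall n z, D z -> `|u n z| <= 1.

(** The weights [h] against which [u n] tends weakly to 0, uniformly over the test sets [B i]. As |u
    n| <= 1, the integrable ones form an L^1-closed vector space, which the next three lemmas
    express. Later [u n] is w - q^n and the [B i] are the boxes over a window. *)
Definition uniformly_null (h : Z -> R) := forall e, 0 < e ->
  \forall n \near \oo, forall i, `|\int[mu]_(z in B i) (h z * u n z)| <= e.

Let intD h := mu.-integrable D (EFin \o h).

Let measurable_int_fun h : intD h -> measurable_fun D h.
Proof. by move=> /measurable_int/measurable_EFinP. Qed.

Let integrable_mul h n : intD h -> intD (fun z => h z * u n z).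
Proof.
move=> ih; apply: le_integrable (ih) => //.
  by apply/measurable_EFinP/measurable_funM; [exact: measurable_int_fun|].
by move=> z Dz /=; rewrite lee_fin normrM ler_piMr// u1.
Qed.

Let integrable_mulB h n i : intD h ->
  mu.-integrable (B i) (EFin \o (fun z => h z * u n z)).
Proof. by move=> /(@integrable_mul h n); apply: integrableS. Qed.

Lemma uniformly_null_approx h : intD h ->
  (forall e, 0 < e -> exists h', [/\ intD h', uniformly_null h' &
     \int[mu]_(z in D) `|h z - h' z| <= e]) -> uniformly_null h.
Proof.
move=> ih happ e e0; have e20 : 0 < e / 2 by rewrite divr_gt0.
have [h' [ih' nh' hh']] := happ _ e20.
have ihh' : intD (fun z => h z - h' z) by exact: (integrableB mD ih ih').
have inorm : intD (fun z => `|h z - h' z|) by exact: (integrable_norm ihh').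
near=> n => i.
have -> : \int[mu]_(z in B i) (h z * u n z) =
    \int[mu]_(z in B i) (h' z * u n z) +
    \int[mu]_(z in B i) ((h z - h' z) * u n z).
  rewrite -RintegralD//; [|exact: integrable_mulB|exact: integrable_mulB].
  by apply: eq_Rintegral => z _; ring.
rewrite (splitr e) (le_trans (ler_normD _ _))// lerD//.
  by move: i; near: n; exact: nh'.
apply: le_trans hh'.
apply: (@le_trans _ _ (\int[mu]_(z in B i) `|h z - h' z|)).
  apply: normr_Rintegral_le_dominated => //.
  - exact/measurable_EFinP/(measurable_int mu)/integrable_mulB.
  - by apply: integrableS inorm.
  - by move=> z /BD Dz; rewrite normrM ler_piMr// u1.
have inormB : mu.-integrable (B i) (EFin \o (fun z => `|h z - h' z|)).
  exact: integrableS inorm.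
rewrite fine_le//.
- exact: integrable_fin_num inormB.
- exact: integrable_fin_num inorm.
apply: ge0_subset_integral => //.
exact: measurable_int inorm.
Unshelve. all: by end_near. Qed.

Lemma uniformly_nullD h1 h2 : intD h1 -> intD h2 ->
  uniformly_null h1 -> uniformly_null h2 ->
  uniformly_null (fun z => h1 z + h2 z).
Proof.
move=> ih1 ih2 n1 n2 e e0; have e20 : 0 < e / 2 by rewrite divr_gt0.
near=> n => i.
have -> : \int[mu]_(z in B i) ((h1 z + h2 z) * u n z) =
    \int[mu]_(z in B i) (h1 z * u n z) + \int[mu]_(z in B i) (h2 z * u n z).
  rewrite -RintegralD//; [|exact: integrable_mulB|exact: integrable_mulB].
  by apply: eq_Rintegral => z _; rewrite mulrDl.
rewrite (splitr e) (le_trans (ler_normD _ _))// lerD//.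
  by move: i; near: n; exact: n1.
by move: i; near: n; exact: n2.
Unshelve. all: by end_near. Qed.

Lemma uniformly_nullZ k h : intD h -> uniformly_null h ->
  uniformly_null (fun z => k * h z).
Proof.
move=> ih nh e e0.
have k0 : 0 < `|k| + 1 by rewrite ltr_wpDl.
have ek : 0 < e / (`|k| + 1) by rewrite divr_gt0.
near=> n => i.
rewrite (@eq_Rintegral _ _ _ _ _ (fun z => k * (h z * u n z))); last first.
  by move=> z _; rewrite mulrA.
rewrite RintegralZl ?normrM//; last exact: integrable_mulB.
apply: (@le_trans _ _ (`|k| * (e / (`|k| + 1)))).
  by rewrite ler_wpM2l//; move: i; near: n; exact: nh.
by rewrite mulrCA ler_piMr ?(ltW e0)// ler_pdivrMr// mul1r lerDl.
Unshelve. all: by end_near. Qed.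

Variable g : Z -> R.
Hypothesis ig : intD g.
Hypothesis g0 : forall z, D z -> 0 <= g z.

Let integrable_mul_bounded (s : Z -> R) (K : R) : measurable_fun D s ->
  (forall z, D z -> `|s z| <= K) -> intD (fun z => s z * g z).
Proof.
move=> ms sK.
have iKg : intD (fun z => K * g z) by exact: (integrableZl mD K ig).
apply: le_integrable iKg => //.
  by apply/measurable_EFinP/measurable_funM => //; exact: measurable_int_fun.
move=> z Dz /=; rewrite lee_fin !normrM ler_pM//.
by rewrite (le_trans (sK z Dz))// ler_norm.
Qed.

Let integrable_indic_mul E : measurable E ->
  intD (fun z => \1_E z * g z).
Proof.
move=> mE; apply: (@integrable_mul_bounded _ 1) => //.
by move=> z _; rewrite indicE ger0_norm// lern1 leq_b1.
Qed.

Let null_set E := measurable E /\ uniformly_null (fun z => \1_E z * g z).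

(** Proper differences follow from linearity. For an increasing union, dominated convergence with
    bound [g] gives L^1 convergence of the weights, and the space of null weights is L^1-closed. *)
Lemma null_set_lambda : null_set setT -> lambda_system setT null_set.
Proof.
move=> nT; split => //.
- move=> E F FE [mE nE] [mF nF]; split; first exact: measurableD.
  have -> : (fun z => \1_(E `\` F) z * g z) =
      (fun z => \1_E z * g z + (-1) * (\1_F z * g z)).
    apply/funext => z; rewrite !indicE in_setD.
    have : z \in F -> z \in E by rewrite !inE; exact: FE.
    by case: (z \in F); case: (z \in E) => /= H; rewrite ?H//; try ring;
      have := H isT.
  apply: uniformly_nullD => //.
  + exact: integrable_indic_mul.
  + exact: (integrableZl mD (-1) (integrable_indic_mul mF)).
  + by apply: uniformly_nullZ => //; exact: integrable_indic_mul.
- move=> F ndF nF; have mF k : measurable (F k) := (nF k).1.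
  have mU : measurable (\bigcup_k F k) by exact: bigcupT_measurable.
  split => //; apply: uniformly_null_approx; first exact: integrable_indic_mul.
  move=> e e0.
  pose f k z := \1_(\bigcup_k F k) z * g z - \1_(F k) z * g z.
  have fE k z : f k z = \1_(\bigcup_k F k `\` F k) z * g z.
    rewrite /f -mulrBl; congr (_ * _); rewrite !indicE in_setD.
    have : z \in F k -> z \in \bigcup_k F k by rewrite !inE => Fz; exists k.
    by case: (z \in F k); case: (z \in _) => //= H; rewrite ?subrr ?subr0//;
      have := H isT.
  have f0 : \int[mu]_(z in D) `|f k z| @[k --> \oo] --> (0 : R).
    apply: (@dominated_cvg_Rintegral0 _ _ g) => //.
    + move=> k; apply/measurable_EFinP.
      apply: (measurable_int mu).
      exact: (integrableB mD
        (integrable_indic_mul mU) (integrable_indic_mul (mF k))).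
    + move=> k z Dz; rewrite fE normrM (ger0_norm (g0 Dz)) ler_piMl ?g0//.
      by rewrite indicE ger0_norm// lern1 leq_b1.
    + move=> z Dz; apply: cvg_near_cst.
      have [[k _ Fkz]|nFz] := pselect ((\bigcup_k F k) z).
        near=> n; rewrite fE indicE in_setD (_ : z \in F n) ?andbF ?mul0r//.
        rewrite inE; move: z Fkz {Dz}; apply/subsetPset/ndF.
        by near: n; exact: nbhs_infty_ge.
      by near=> n; rewrite fE indicE in_setD memNset ?mul0r.
  have /cvgrPdist_le/(_ e e0)[k _ /(_ k (leqnn k))] := f0.
  rewrite sub0r normrN => fk; exists (fun z => \1_(F k) z * g z); split.
  + exact: integrable_indic_mul.
  + exact: (nF k).2.
  + by apply: le_trans fk; rewrite ler_norm.
Unshelve. all: by end_near. Qed.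


Variable C : set (set Z).
Hypothesis CI : setI_closed C.
Hypothesis CT : C setT.
Hypothesis generatedC : @measurable d Z = <<s C >>.
Hypothesis nullC : forall E, C E -> uniformly_null (fun z => \1_E z * g z).

(** Dynkin's theorem: [C] is stable under intersection and generates the sigma-algebra. *)
Let null_measurable E : measurable E ->
  uniformly_null (fun z => \1_E z * g z).
Proof.
have CM : C `<=` measurable by rewrite generatedC; exact: sub_gen_smallest.
suff : (@measurable d Z) `<=` null_set by move=> + mE => /(_ _ mE)[].
rewrite generatedC; apply: lambda_system_subset => //.
- by apply: null_set_lambda; split; [exact: CM|exact: nullC].
- by move=> F CF; split; [exact: CM|exact: nullC].
Qed.

Import HBNNSimple.

Let null_nnsfun (s : {nnsfun Z >-> R}) : uniformly_null (fun z => s z * g z).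
Proof.
pose term y z := y * (\1_(s @^-1` [set y]) z * g z).
suff sum_null (r : seq R) : intD (fun z => \sum_(y <- r) term y z) /\
    uniformly_null (fun z => \sum_(y <- r) term y z).
  have [_] := sum_null (finmap.enum_fset (fset_set (range s))).
  congr uniformly_null; apply/funext => z.
  rewrite fimfunE fsbig_finite//= mulr_suml.
  by apply: eq_bigr => y _; rewrite /term mulrA.
have mterm y : measurable (s @^-1` [set y]) by [].
have iterm y : intD (term y).
  exact: (integrableZl mD y (integrable_indic_mul (mterm y))).
elim: r => [|y r [ir nr]].
  under eq_fun do rewrite big_nil; split; first exact: integrable0.
  move=> e e0; near=> n => i; rewrite (@eq_Rintegral _ _ _ _ _ (fun=> 0)).
    by rewrite Rintegral_cst// mul0r normr0 ltW.
  by move=> z _; rewrite mul0r.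
under eq_fun do rewrite big_cons; split.
  exact: (integrableD mD (iterm y) ir).
apply: uniformly_nullD => //; apply: uniformly_nullZ.
  exact: integrable_indic_mul.
exact: null_measurable.
Unshelve. all: by end_near. Qed.

Hypothesis Dfin : (mu D < +oo)%E.
Hypothesis g_gt0 : {ae mu, forall z, D z -> 0 < g z}.

(** Almost everywhere on [D] the weight 1 is [g^-1 * g], the L^1 limit of [s k * g] for simple
    functions [s k] increasing to [g^-1]; all these products are bounded by 1 on a set of finite
    measure. *)
Lemma uniformly_null1 : uniformly_null (fun=> 1).
Proof.
pose h z := (g z)^-1.
have mg : measurable_fun D g by exact: measurable_int_fun.
have mh : measurable_fun D h.
  apply: (eq_measurable_fun (fun z => g z `^ (-1))).
    by move=> z /set_mem Dz; rewrite /h powR_inv1// g0.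
  by apply: (measurableT_comp (measurable_powR _)).
(* Where [g] vanishes its inverse is 0 by default, so the product is 0 there and not 1. *)
have hg z : D z -> 0 <= h z * g z <= 1.
  move=> Dz; have := g0 Dz; rewrite le_eqVlt => /predU1P[<-|gz].
    by rewrite mulr0 lexx ler01.
  by rewrite /h mulVf ?gt_eqF// ler01 lexx.
have i1 : intD (fun=> 1).
  by apply: (@integrable_bounded _ _ _ _ _ _ 1) => // z _; rewrite normr1.
have mhg : measurable_fun D (fun z => h z * g z) by exact: measurable_funM.
have ihg : intD (fun z => h z * g z).
  apply: (@integrable_bounded _ _ _ _ _ _ 1) => // z Dz.
  by have /andP[? ?] := hg z Dz; rewrite ger0_norm.
(* Two approximations are nested: 1 by [h * g], at L^1 distance 0, and [h * g] by simple multiples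
   of [g]. *)
apply: uniformly_null_approx => // e e0; exists (fun z => h z * g z); split=> //.
  apply: uniformly_null_approx => // {}e {}e0.
  have mEh : measurable_fun D (EFin \o h) by exact/measurable_EFinP.
  have h0 z : D z -> (0 <= (EFin \o h) z)%E.
    by move=> Dz; rewrite lee_fin invr_ge0 g0.
  pose s := nnsfun_approx mD mEh.
  have sh k z : D z -> 0 <= s k z <= h z.
    move=> Dz; rewrite fun_ge0 /=.
    have cvgs := cvg_nnsfun_approx mD mEh h0 Dz.
    have {}cvgs : s ^~ z @ \oo --> h z by move/fine_cvg : cvgs.
    rewrite -(cvg_lim (@Rhausdorff R) cvgs).
    apply: nondecreasing_cvgn_le; last by apply/cvg_ex; exists (h z).
    by move=> m n mn; exact/lefP/nd_nnsfun_approx.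
  have ms k : measurable_fun D (s k) by exact: measurable_funTS.
  have isg k : intD (fun z => s k z * g z).
    apply: (@integrable_bounded _ _ _ _ _ _ 1) => //.
      exact: measurable_funM.
    move=> z Dz; have /andP[s0 s1] := sh k z Dz; have /andP[_ g1] := hg z Dz.
    rewrite ger0_norm ?mulr_ge0 ?g0//; apply: le_trans g1.
    by rewrite ler_wpM2r ?g0.
  have f0 : \int[mu]_(z in D) `|h z * g z - s k z * g z| @[k --> \oo] --> (0 : R).
    apply: (@dominated_cvg_Rintegral0 _ _ (fun=> 1)) => //.
    + move=> k; apply: measurable_funB => //; exact: measurable_funM.
    + move=> k z Dz; have /andP[s0 s1] := sh k z Dz; have /andP[_ g1] := hg z Dz.
      rewrite -mulrBl ger0_norm ?mulr_ge0 ?g0 ?subr_ge0//; apply: le_trans g1.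
      by rewrite ler_wpM2r ?g0// gerBl.
    + move=> z Dz; rewrite -[X in _ --> X](subrr (h z * g z)).
      apply: cvgB; first exact: cvg_cst.
      apply: cvgM; last exact: cvg_cst.
      by have /fine_cvg := cvg_nnsfun_approx mD mEh h0 Dz.
  have /cvgrPdist_le/(_ e e0)[k _ /(_ k (leqnn k))] := f0.
  rewrite sub0r normrN => fk; exists (fun z => s k z * g z); split => //.
  by apply: le_trans fk; rewrite ler_norm.
rewrite (_ : \int[mu]_(z in D) _ = 0) ?ltW//.
rewrite /Rintegral (ae_eq_integral (cst 0%E)) ?integral0//.
  apply/measurable_EFinP/measurableT_comp => //.
  exact: measurable_funB.
have [N [mN N0 gN]] := g_gt0; exists N; split => // z /= /not_implyP[Dz neq].
apply: gN => /= /(_ Dz) gz; apply: neq.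
by rewrite /h mulVf ?gt_eqF// subrr normr0.
Qed.

End uniform_weak_convergence.

(** * Step kernels *)

Section step_kernels.
Variable R : realType.
Local Notation M := (measurableTypeR R).

Lemma weighted_sum_le n (alpha r : 'I_n -> R) :
  (forall i, 0 <= alpha i <= 1) ->
  \sum_i alpha i * r i <= \sum_(i in [set i | 0 <= r i]%SET) r i.
Proof.
move=> alpha01; rewrite [leRHS]big_mkcond; apply: ler_sum => i _.
rewrite inE; have /andP[a0 a1] := alpha01 i.
by case: (leP 0 (r i)) => ri; [rewrite ler_piMl|rewrite mulr_ge0_le0// ltW].
Qed.

(* A bilinear form on [0,1]^n x [0,1]^n is extremal at 0-1 vectors. *)
Lemma bilinear_le n (D : 'I_n -> 'I_n -> R) (alpha beta : 'I_n -> R) (K : R) :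
  (forall i, 0 <= alpha i <= 1) -> (forall i, 0 <= beta i <= 1) ->
  (forall I J : {set 'I_n}, `|\sum_(i in I) \sum_(j in J) D i j| <= K) ->
  `|\sum_i \sum_j alpha i * beta j * D i j| <= K.
Proof.
move=> alpha01 beta01.
(* The upper bound for [- D] is the lower bound for [D]. *)
suff upper (E : 'I_n -> 'I_n -> R) :
    (forall I J : {set 'I_n}, `|\sum_(i in I) \sum_(j in J) E i j| <= K) ->
    \sum_i \sum_j alpha i * beta j * E i j <= K.
  move=> DK; rewrite ler_norml upper// andbT lerNl -sumrN.
  rewrite [leLHS](_ : _ = \sum_i \sum_j alpha i * beta j * - D i j).
    apply: upper => I J.
    rewrite [X in `|X|](_ : _ = - \sum_(i in I) \sum_(j in J) D i j) ?normrN//.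
    by rewrite -sumrN; apply: eq_bigr => i _; rewrite sumrN.
  by apply: eq_bigr => i _; rewrite -sumrN; apply: eq_bigr => j _; rewrite mulrN.
move=> EK.
under eq_bigr do under eq_bigr do rewrite -mulrA.
under eq_bigr do rewrite -mulr_sumr.
(* With [beta] frozen the form is linear in [alpha], hence largest at the indicator of its
   non-negative coefficients; the same is then done for [beta]. *)
apply: le_trans (weighted_sum_le _ alpha01) _; set I := [set i | _]%SET.
rewrite exchange_big/=; under eq_bigr do rewrite -mulr_sumr.
apply: le_trans (weighted_sum_le _ beta01) _; set J := [set j | _]%SET.
by rewrite exchange_big/=; exact: le_trans (ler_norm _) (EK I J).
Qed.

Lemma leb2_setX (A B : set M) : measurable A -> measurable B ->
  leb2 R (A `*` B) = (leb1 R A * leb1 R B)%E.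
Proof. exact: (@product_measure1E _ _ _ _ R (leb1 R) (leb1 R)). Qed.

Lemma measurable_cell n (i : 'I_n) : measurable (cell i : set M).
Proof. by rewrite /cell; case: ifP => _; exact: measurable_itv. Qed.

Lemma leb1_cell n (i : 'I_n) : leb1 R (@cell R n i) = (n%:R^-1)%:E.
Proof.
have n0 : 0 < n%:R :> R by rewrite ltr0n (leq_ltn_trans _ (ltn_ord i)).
rewrite /cell; case: ifPn => _; rewrite leb1_itv/= lte_fin.
  by rewrite invr_gt0 n0 oppr0 adde0.
by rewrite ltr_pM2r ?invr_gt0// ltr_nat ltnSn -EFinB -mulrBl -natrB// subSnn mul1r.
Qed.

(** Take the least k with x <= (k + 1) / n. Minimality gives k / n < x when k > 0, and the cell of
    index 0 contains its left end. *)
Lemma cell_exists n (x : R) : (0 < n)%N -> 0 <= x <= 1 ->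
  exists i : 'I_n, cell i x.
Proof.
move=> n0 /andP[x0 x1].
have exk : exists k, x <= k.+1%:R / n%:R.
  by exists n.-1; rewrite prednK// divff// pnatr_eq0 -lt0n.
case: (ex_minnP exk) => k xk kmin.
have kn : (k < n)%N.
  rewrite -[n]prednK// ltnS; apply: kmin.
  by rewrite prednK// divff// pnatr_eq0 -lt0n.
exists (Ordinal kn); rewrite /cell/=; case: eqP => [k0|/eqP k0] /=; rewrite in_itv/=.
  by rewrite x0 -[n%:R^-1]mul1r; move: xk; rewrite k0.
rewrite xk andbT ltNge; apply/negP => xk'.
have := kmin k.-1; rewrite prednK ?lt0n// => /(_ xk').
by rewrite leqNgt prednK ?lt0n// leqnn.
Qed.

Lemma cell_inj n (i j : 'I_n) (x : R) : cell i x -> cell j x -> i = j.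
Proof.
have n0 : 0 < n%:R :> R by rewrite ltr0n (leq_ltn_trans _ (ltn_ord i)).
wlog ij : i j / (i <= j)%N => [H|].
  by case: (leqP i j) => [|/ltnW] ij ix jx; [|apply/esym]; exact: H ij _ _.
move=> ix jx; apply/val_inj/eqP; rewrite eqn_leq ij/= leqNgt; apply/negP => ltij.
have xi : x <= i.+1%:R / n%:R.
  move: ix; rewrite /cell; case: ifPn => [/eqP ->|_] /=; rewrite in_itv/=.
    by rewrite mul1r => /andP[].
  by move=> /andP[].
have : j%:R / n%:R < x.
  move: jx; rewrite /cell; case: ifPn => [/eqP j0|_] /=.
    by move: ltij; rewrite j0.
  by rewrite in_itv/= => /andP[].
by rewrite ltNge (le_trans xi)// ler_pM2r ?invr_gt0// ler_nat.
Qed.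

(** The indices are chosen before [c], so one cell serves the rates and the means at all times. *)
Lemma step_kernel_cell n (xy : R * R) : (0 < n)%N -> square R xy ->
  exists i j : 'I_n, forall c, step_kernel c xy = c i j.
Proof.
move=> n0 [/= x01 y01].
have [i ix] := cell_exists n0 x01; have [j jy] := cell_exists n0 y01.
exists i, j => c; rewrite /step_kernel (bigD1 i)//= (bigD1 j)//=.
rewrite indicE mem_set; last by split.
rewrite mulr1 big1 ?addr0 => [|k kj]; last first.
  rewrite indicE memNset ?mulr0// => -[_ /= ky]; move/eqP: kj; apply.
  exact: cell_inj ky jy.
rewrite big1 ?addr0// => k ki; rewrite big1// => l _.
rewrite indicE memNset ?mulr0// => -[/= kx _]; move/eqP: ki; apply.
exact: cell_inj kx ix.
Qed.

Lemma step_kernelB n (c c' : 'I_n -> 'I_n -> R) xy :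
  step_kernel c xy - step_kernel c' xy =
  step_kernel (fun i j => c i j - c' i j) xy.
Proof.
rewrite /step_kernel -sumrB; apply: eq_bigr => i _; rewrite -sumrB.
by apply: eq_bigr => j _; rewrite mulrBl.
Qed.

Lemma Rintegral_step_kernel n (c : 'I_n -> 'I_n -> R) (A B : set M) :
  measurable A -> measurable B -> A `<=` `[0, 1] -> B `<=` `[0, 1] ->
  \int[leb2 R]_(z in A `*` B) step_kernel c z =
  \sum_(i < n) \sum_(j < n)
    c i j * (fine (leb1 R (A `&` cell i)) * fine (leb1 R (B `&` cell j))).
Proof.
move=> mA mB A1 B1; have mAB : measurable (A `*` B) by exact: measurableX.
have ABfin : (leb2 R (A `*` B) < +oo)%E.
  by rewrite (le_lt_trans (leb2_rect_le1 mA mB A1 B1))// ltry.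
have mQ (i j : 'I_n) : measurable (@cell R n i `*` @cell R n j : set (M * M)).
  by apply: measurableX; exact: measurable_cell.
have m1 (i j : 'I_n) :
    measurable_fun (A `*` B) (\1_(@cell R n i `*` @cell R n j) : _ -> R).
  exact: measurable_indic.
have i1 (i j : 'I_n) : (leb2 R).-integrable (A `*` B)
    (EFin \o (\1_(@cell R n i `*` @cell R n j) : _ -> R)).
  apply: (@integrable_bounded _ _ _ _ _ _ 1) => // z _.
  by rewrite indicE ger0_norm// lern1 leq_b1.
have ic i j : (leb2 R).-integrable (A `*` B)
    (EFin \o (fun z => c i j * \1_(@cell R n i `*` @cell R n j) z)).
  exact: (integrableZl mAB (c i j) (i1 i j)).
rewrite Rintegral_sum//; last first.
  by move=> i; exact: (integrable_sum_EFin mAB).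
apply: eq_bigr => i _; rewrite Rintegral_sum//; apply: eq_bigr => j _.
rewrite RintegralZl//; congr (_ * _).
rewrite /Rintegral integral_indic//.
have finA (E : set M) (k : 'I_n) : measurable E ->
    leb1 R (E `&` cell k) \is a fin_num.
  move=> mE; rewrite ge0_fin_numE//.
  apply: (@le_lt_trans _ _ (leb1 R (@cell R n k))).
    apply: le_measure; rewrite ?inE; [|exact: measurable_cell|exact: subIsetr].
    by apply: measurableI => //; exact: measurable_cell.
  by rewrite leb1_cell ltry.
rewrite -fineM ?finA// setIC -setXI; congr fine.
by apply: leb2_setX; apply: measurableI => //; exact: measurable_cell.
Qed.

(** A test over A x B is bilinear in the fractions of the cells covered by A and by B. By
    [bilinear_le] only fractions 0 and 1, that is unions of cells, matter. *)
Lemma cut_le_step_kernel n (c c' : 'I_n -> 'I_n -> R) (e : R) : (0 < n)%N ->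
  (forall I J : {set 'I_n},
    `|\sum_(i in I) \sum_(j in J) (c i j - c' i j)| <= e * (n * n)%:R) ->
  cut_le (step_kernel c) (step_kernel c') e.
Proof.
move=> n_gt0 IJ A B mA mB A1 B1; have n0 : 0 < n%:R :> R by rewrite ltr0n.
under eq_Rintegral do rewrite step_kernelB.
rewrite Rintegral_step_kernel//.
have frac (E : set M) (mE : measurable E) (i : 'I_n) :
    0 <= n%:R * fine (leb1 R (E `&` cell i)) <= 1.
  have cfin : leb1 R (@cell R n i) \is a fin_num by rewrite leb1_cell.
  have Ele : (leb1 R (E `&` cell i) <= leb1 R (@cell R n i))%E.
    apply: le_measure; rewrite ?inE; [|exact: measurable_cell|exact: subIsetr].
    by apply: measurableI => //; exact: measurable_cell.
  rewrite mulr_ge0//=; last exact: fine_ge0.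
  rewrite -ler_pdivlMl// mulr1 (_ : n%:R^-1 = fine (leb1 R (@cell R n i))).
    apply: fine_le => //; rewrite ge0_fin_numE// (le_lt_trans Ele)//.
    by rewrite leb1_cell ltry.
  by rewrite leb1_cell.
have := bilinear_le (frac A mA) (frac B mB) IJ.
set S := (X in _ -> `|X| <= _).
have -> : (\sum_i \sum_j n%:R * fine (leb1 R (A `&` cell i)) *
    (n%:R * fine (leb1 R (B `&` cell j))) * (c i j - c' i j)) = S * (n * n)%:R.
  rewrite mulr_suml; apply: eq_bigr => i _; rewrite mulr_suml.
  by apply: eq_bigr => j _; rewrite natrM; ring.
by rewrite normrM (@ger0_norm _ (n * n)%:R)// ler_pM2r// natrM mulr_gt0.
Qed.

End step_kernels.

(** * Concentration in the cut norm *)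

Section finite_hoeffding.
Variable R : realType.

(** From exp(-y) >= 1 - y follows (1 - y) exp(y) <= 1, while (1 - y)(1 + y + 2 y^2) = 1 + y^2 (1 - 2
    y) >= 1. *)
Lemma expR_le_quadratic (y : R) : `|y| <= 1 / 2 ->
  expR y <= 1 + y + 2 * y ^+ 2.
Proof.
rewrite ler_norml => /andP[y1 y2].
have ey := expR_gt0 y.
have : (1 - y) * expR y <= 1.
  by rewrite -ler_pdivlMr// div1r -expRN; exact: expR_ge1Dx.
move: (expR y) ey => e e0 ye.
have : 1 <= (1 - y) * (1 + y + 2 * y ^+ 2) by nra.
have y0 : 0 < 1 - y by lra.
by move=> h; rewrite -(ler_pM2l y0) (le_trans ye).
Qed.

Variables (I V : finType) (p x : I -> V -> R) (t : I -> R) (delta : R).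
Hypothesis p_ge0 : forall i v, 0 <= p i v.
Hypothesis p_sum : forall i, \sum_v p i v = 1.
Hypothesis x_le1 : forall i v, `|x i v| <= 1.
Hypothesis x_mean0 : forall i, \sum_v p i v * x i v = 0.
Hypothesis t_le1 : forall i, `|t i| <= 1.
Hypothesis delta01 : 0 < delta <= 1.

(** Exponential Markov inequality with parameter l = delta / 4. As the mean is 0, each factor of the
    moment generating function is at most exp(2 l^2), and 2 l^2 - l delta = - delta^2 / 8. The bound
    delta <= 1 keeps l below 1 / 2, as the quadratic estimate requires. *)
Lemma hoeffding_finite :
  \sum_(f : {ffun I -> V} | delta * #|I|%:R <= \sum_i t i * x i (f i))
    \prod_i p i (f i) <= expR (- (delta ^+ 2 / 8) * #|I|%:R).
Proof.
have /andP[d0 d1] := delta01; pose l := delta / 4.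
have l0 : 0 < l by rewrite divr_gt0.
have mgf i : \sum_v p i v * expR (l * (t i * x i v)) <= expR (2 * l ^+ 2).
  apply: (@le_trans _ _ (1 + 2 * l ^+ 2)); last exact: expR_ge1Dx.
  apply: (@le_trans _ _ (\sum_v (p i v + (l * t i) * (p i v * x i v) +
      p i v * (2 * l ^+ 2)))).
    apply: ler_sum => v _.
    have tx : `|t i * x i v| <= 1 by rewrite normrM mulr_ile1.
    have -> : p i v + l * t i * (p i v * x i v) + p i v * (2 * l ^+ 2) =
        p i v * (1 + l * (t i * x i v) + 2 * l ^+ 2) by ring.
    rewrite ler_wpM2l//; move: tx; move: (t i * x i v) => s s1.
    apply: le_trans (expR_le_quadratic _) _.
      rewrite normrM (ger0_norm (ltW l0)) (@le_trans _ _ l)//; last by rewrite /l; lra.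
      by rewrite ler_piMr// ltW.
    rewrite lerD2l ler_pM2l// exprMn ler_piMr ?sqr_ge0//.
    by rewrite -real_normK ?num_real// exprn_ile1.
  rewrite !big_split/= -mulr_sumr x_mean0 mulr0 addr0 -mulr_suml p_sum.
  by rewrite mul1r.
apply: (@le_trans _ _ (\sum_(f : {ffun I -> V}) \prod_i p i (f i) *
    expR (l * (\sum_i t i * x i (f i) - delta * #|I|%:R)))).
  rewrite big_mkcond; apply: ler_sum => f _.
  have P0 : 0 <= \prod_i p i (f i) by apply: prodr_ge0.
  case: ifPn => [df|_]; last by rewrite mulr_ge0// expR_ge0.
  apply: ler_peMr => //; rewrite -[leLHS]expR0 ler_expR.
  by apply: mulr_ge0; rewrite ?subr_ge0// ltW.
under eq_bigr => f _.
  rewrite mulrBr expRD mulr_sumr expR_sum mulrA -big_split/=.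
  over.
rewrite -mulr_suml.
(* Independence: under the product weights the expectation of a product is the product of
   expectations. *)
rewrite -(bigA_distr_bigA (fun i v => p i v * expR (l * (t i * x i v)))).
apply: (@le_trans _ _ (\prod_(i : I) expR (2 * l ^+ 2) * expR (- (l * (delta * #|I|%:R))))).
  rewrite ler_wpM2r ?expR_ge0//; apply: ler_prod => i _; rewrite mgf andbT.
  by apply: sumr_ge0 => v _; rewrite mulr_ge0// expR_ge0.
rewrite prodr_const -expRM_natl -expRD ler_expR /l.
by rewrite le_eqVlt; apply/orP; left; apply/eqP; field.
Qed.

End finite_hoeffding.

Section cut_norm_concentration.
Variable R : realType.

Lemma sumr_exists_le (K W : finType) (Q : K -> pred W) (F : W -> R) :
  (forall f, 0 <= F f) ->
  \sum_(f | [exists k, Q k f]) F f <= \sum_k \sum_(f | Q k f) F f.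
Proof.
move=> F0; rewrite (exchange_big_dep xpredT)//= big_mkcond; apply: ler_sum => f _.
case: ifPn => [/existsP[k Qk]|_]; last by apply: sumr_ge0 => k _; exact: F0.
by rewrite (bigD1 k)//= lerDl sumr_ge0.
Qed.

Variables (n : nat) (V : finType) (p x : 'I_n * 'I_n -> V -> R) (delta : R).
Hypothesis p_ge0 : forall e v, 0 <= p e v.
Hypothesis p_sum : forall e, \sum_v p e v = 1.
Hypothesis x_le1 : forall e v, `|x e v| <= 1.
Hypothesis x_mean0 : forall e, \sum_v p e v * x e v = 0.
Hypothesis delta01 : 0 < delta <= 1.

(** Union bound over the two index sets and a sign, 2 * 4^n cases; each is a linear form with
    coefficients -1, 0 or 1, to which [hoeffding_finite] applies. *)
Lemma cut_norm_concentration :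
  \sum_(f : {ffun 'I_n * 'I_n -> V} | [exists IJ : {set 'I_n} * {set 'I_n},
      delta * (n * n)%:R <=
        `|\sum_(i in IJ.1) \sum_(j in IJ.2) x (i, j) (f (i, j))|])
    \prod_e p e (f e) <=
  2 * 4 ^+ n * expR (- (delta ^+ 2 / 8) * (n * n)%:R).
Proof.
pose t (k : {set 'I_n} * {set 'I_n} * bool) (e : 'I_n * 'I_n) : R :=
  (-1) ^+ k.2 * ((e.1 \in k.1.1) && (e.2 \in k.1.2))%:R.
have t1 k e : `|t k e| <= 1.
  by rewrite normrM normr_sign mul1r normr_nat lern1 leq_b1.
pose Q k (f : {ffun 'I_n * 'I_n -> V}) :=
  delta * #|{: 'I_n * 'I_n}|%:R <= \sum_e t k e * x e (f e).
have card_edges : #|{: 'I_n * 'I_n}| = (n * n)%N by rewrite card_prod !card_ord.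
have sum_edges k (f : {ffun 'I_n * 'I_n -> V}) : \sum_e t k e * x e (f e) =
    (-1) ^+ k.2 * \sum_(i in k.1.1) \sum_(j in k.1.2) x (i, j) (f (i, j)).
  transitivity (\sum_i \sum_j t k (i, j) * x (i, j) (f (i, j))).
    by rewrite pair_bigA; apply: eq_bigr => -[].
  rewrite mulr_sumr [RHS]big_mkcond; apply: eq_bigr => i _.
  case: ifPn => ik; rewrite ?mulr_sumr.
    rewrite [RHS]big_mkcond; apply: eq_bigr => j _.
    by rewrite /t/= ik/=; case: ifPn => _; rewrite ?mulr1 ?mulr0 ?mul0r.
  by apply: big1 => j _; rewrite /t/= (negPf ik)/= mulr0 mul0r.
apply: (@le_trans _ _ (\sum_(f | [exists k, Q k f]) \prod_e p e (f e))).
  rewrite big_mkcond [leRHS]big_mkcond; apply: ler_sum => f _.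
  case: ifPn => [/existsP[IJ IJf]|_]; last first.
    by case: ifP => // _; apply: prodr_ge0.
  rewrite ifT//; apply/existsP.
  have [S0|S0] := leP 0 (\sum_(i in IJ.1) \sum_(j in IJ.2) x (i, j) (f (i, j))).
    exists (IJ, false).
    by rewrite /Q sum_edges card_edges/= mul1r (le_trans IJf)// ger0_norm.
  exists (IJ, true).
  by rewrite /Q sum_edges card_edges/= mulN1r (le_trans IJf)// ltr0_norm.
apply: le_trans (sumr_exists_le _ _) _.
  by move=> f; apply: prodr_ge0.
apply: (@le_trans _ _ (\sum_(k : {set 'I_n} * {set 'I_n} * bool)
    expR (- (delta ^+ 2 / 8) * (n * n)%:R))).
  by apply: ler_sum => k _; rewrite -card_edges; exact: hoeffding_finite.
have card_sets : #|{set 'I_n}| = (2 ^ n)%N.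
  by rewrite -cardsT -powersetT card_powerset cardsT card_ord.
rewrite sumr_const !card_prod card_bool card_sets -expnMn -[leLHS]mulr_natl.
by rewrite ler_wpM2r ?expR_ge0// natrM natrX mulrC.
Qed.

End cut_norm_concentration.

Section concentration.
Context (R : realType) d (Omega : measurableType d) (P : probability Omega R).

Let Pfin : ((P : {measure set Omega -> \bar R}) setT < +oo)%E.
Proof. by apply: (@le_lt_trans _ _ 1%E); [exact: probability_le1|rewrite ltry]. Qed.

Section finite_valued.
Variables (W : finType) (G : Omega -> W).
Hypothesis mG : forall k, measurable (G @^-1` [set k]).

Lemma measurable_finite_preimage (Q : pred W) :
  measurable [set w | Q (G w)].
Proof.
rewrite (_ : [set w | _] = \big[setU/set0]_(k | Q k) (G @^-1` [set k])).
  exact: bigsetU_measurable.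
rewrite -bigcup_seq_cond; apply/seteqP; split=> [w /= Qw|w [k /= /andP[_ Qk] Gk]]; last by rewrite /= Gk.
by exists (G w) => //=; rewrite mem_index_enum.
Qed.

Lemma Rintegral_finite_valued (phi : W -> R) :
  \int[P]_w phi (G w) = \sum_k phi k * fine (P (G @^-1` [set k])).
Proof.
have m1 k : measurable_fun setT (\1_(G @^-1` [set k]) : Omega -> R).
  exact: measurable_indic.
have i1 k : P.-integrable setT (EFin \o (\1_(G @^-1` [set k]) : Omega -> R)).
  exact: integrable_indic.
have ic k : P.-integrable setT
    (EFin \o (fun w => phi k * \1_(G @^-1` [set k]) w)).
  exact: (integrableZl measurableT (phi k) (i1 k)).
transitivity (\int[P]_w \sum_k phi k * \1_(G @^-1` [set k]) w).
  apply: eq_Rintegral => w _; rewrite (bigD1 (G w))//= indicE mem_set// mulr1.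
  rewrite big1 ?addr0// => k kG; rewrite indicE memNset ?mulr0//= => Gk.
  by move: kG; rewrite Gk eqxx.
rewrite Rintegral_sum//; apply: eq_bigr => k _; rewrite RintegralZl//.
by congr (_ * _); rewrite /Rintegral integral_indic ?setIT.
Qed.

End finite_valued.

Variables (n : nat) (Sg : 'I_n * 'I_n -> set (set Omega)).
Variable Y : 'I_n * 'I_n -> Omega -> R.
Hypothesis SgD : forall e A B, Sg e A -> Sg e B -> Sg e (A `\` B).
Hypothesis Sg_sub : forall e, Sg e `<=` measurable.
Hypothesis Sg_indep : forall E : 'I_n * 'I_n -> set Omega,
  (forall e, Sg e (E e)) -> P (\bigcap_e E e) = (\prod_e P (E e))%E.
Hypothesis SgY : forall e r, Sg e [set w | r <= Y e w].
Hypothesis Y01 : forall e w, 0 <= Y e w <= 1.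
Variable delta : R.
Hypothesis delta01 : 0 < delta <= 1.

Let d0 : 0 < delta. Proof. by case/andP: delta01. Qed.

(** The Hoeffding bound concerns finitely many values, so [Y] is rounded down to multiples of 1 / m.
    Rounding shifts a value and its mean by at most 1 / m each, and 2 / m <= delta / 2. *)
Let m : nat := (Num.truncn (4 / delta)).+1.

Let m0 : 0 < m%:R :> R. Proof. by rewrite ltr0n. Qed.

Let m_delta : 4 / m%:R <= delta.
Proof.
rewrite ler_pdivrMr// -ler_pdivrMl// mulrC ltW//.
by have /andP[] := truncn_itv (divr_ge0 (ler0n R 4) (ltW d0)).
Qed.

Let Z e w : 'I_m.+1 := inord (Num.truncn (m%:R * Y e w)).

Let valZ e w : Z e w = Num.truncn (m%:R * Y e w) :> nat.
Proof.
have /andP[Y0 Y1] := Y01 e w.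
have /andP[le _] := truncn_itv (mulr_ge0 (ltW m0) Y0).
have {}le : ((Num.truncn (m%:R * Y e w))%:R : R) <= m%:R.
  by apply: le_trans le _; rewrite ler_piMr// ltW.
by rewrite inordK// ltnS -(ler_nat R).
Qed.

Let Z_itv e w : (Z e w)%:R / m%:R <= Y e w < (Z e w)%:R / m%:R + m%:R^-1.
Proof.
have /andP[Y0 Y1] := Y01 e w; rewrite valZ.
have /andP[le lt] := truncn_itv (mulr_ge0 (ltW m0) Y0).
rewrite ler_pdivrMr// (mulrC (Y e w)) le/=.
by rewrite -[X in _ + X]mul1r -mulrDl ltr_pdivlMr// natr1 (mulrC (Y e w)).
Qed.

(** A difference of two upper level sets of [Y], so the event stays in [Sg e], where independence
    holds. *)
Let ZE e k : Z e @^-1` [set k] =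
  [set w | k%:R / m%:R <= Y e w] `\` [set w | k.+1%:R / m%:R <= Y e w].
Proof.
apply/seteqP; split => w /=.
  move=> <-; have /andP[le lt] := Z_itv e w; split=> //; apply/negP.
  by rewrite -ltNge -natr1 mulrDl mul1r.
move=> [le /negP]; rewrite -ltNge => lt; apply/val_inj => /=.
rewrite valZ; apply: truncn_def.
by rewrite mulrC -ler_pdivrMr// le/= -ltr_pdivlMr.
Qed.

Let SgZ e k : Sg e (Z e @^-1` [set k]).
Proof. by rewrite ZE; apply: SgD; exact: SgY. Qed.

Let mZ e k : measurable (Z e @^-1` [set k]).
Proof. exact: Sg_sub (SgZ e k). Qed.

Let p e k := fine (P (Z e @^-1` [set k])).

Let y (k : 'I_m.+1) : R := k%:R / m%:R.

Let y01 k : 0 <= y k <= 1.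
Proof.
rewrite divr_ge0//= ler_pdivrMr// mul1r ler_nat.
by rewrite -ltnS.
Qed.

Let ybar e := \sum_k p e k * y k.

Let p_ge0 e k : 0 <= p e k. Proof. exact: fine_ge0. Qed.

Let p_sum e : \sum_k p e k = 1.
Proof.
have := Rintegral_finite_valued (mZ e) (fun=> 1).
rewrite Rintegral_cst// mul1r (_ : fine _ = 1) => [->|]; last first.
  exact: (congr1 fine (probability_setT P)).
by apply: eq_bigr => k _; rewrite mul1r.
Qed.

Let ybarE e : ybar e = \int[P]_w y (Z e w).
Proof.
by rewrite (Rintegral_finite_valued (mZ e)); apply: eq_bigr => k _; rewrite mulrC.
Qed.

Let ybar01 e : 0 <= ybar e <= 1.
Proof.
apply/andP; split.
  by apply: sumr_ge0 => k _; rewrite mulr_ge0//; have /andP[] := y01 k.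
rewrite -(p_sum e); apply: ler_sum => k _.
by rewrite ler_piMr//; have /andP[] := y01 k.
Qed.

Let x e k := y k - ybar e.

Let x_le1 e k : `|x e k| <= 1.
Proof.
have /andP[? ?] := y01 k; have /andP[? ?] := ybar01 e.
by rewrite ler_norml /x; apply/andP; split; lra.
Qed.

Let x_mean0 e : \sum_k p e k * x e k = 0.
Proof.
rewrite /x; under eq_bigr do rewrite mulrBr.
by rewrite sumrB -mulr_suml p_sum mul1r subrr.
Qed.

Let mY e : measurable_fun setT (Y e).
Proof.
apply: (measurability _ (RGenCInfty.measurableE R)) => //.
move=> _ [_ [r ->] <-]; rewrite setTI.
have := Sg_sub (SgY e r); congr measurable.
by apply/seteqP; split => w /=; rewrite in_itv/= andbT.
Qed.

Let ybar_approx e w : `|(Y e w - \int[P]_w Y e w) - x e (Z e w)| <= 2 / m%:R.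
Proof.
have iY : P.-integrable setT (EFin \o Y e).
  apply: (@integrable_bounded _ _ _ _ _ _ 1) => //.
  by move=> v _; have /andP[? ?] := Y01 e v; rewrite ger0_norm.
have myZ : measurable_fun setT (fun v => y (Z e v)).
  move=> _ A _; rewrite setTI.
  rewrite (_ : _ @^-1` _ = [set v | `[< A (y (Z e v)) >]]).
    exact: (measurable_finite_preimage (mZ e) (fun k => `[< A (y k) >])).
  by apply/seteqP; split => v /= /asboolP.
have iyZ : P.-integrable setT (EFin \o (fun v => y (Z e v))).
  apply: (@integrable_bounded _ _ _ _ _ _ 1) => //.
  by move=> v _; have /andP[? ?] := y01 (Z e v); rewrite ger0_norm.
have EY : `|\int[P]_w Y e w - ybar e| <= m%:R^-1.
  rewrite ybarE -RintegralB//.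
  rewrite -[leRHS]mulr1 -[X in _ * X](congr1 fine (probability_setT P)).
  apply: normr_Rintegral_le => //.
    exact: measurable_funB.
  move=> v _; have := Z_itv e v; rewrite -/(y (Z e v)) => /andP[? ?].
  by rewrite ler_norml; apply/andP; split; lra.
have := Z_itv e w; rewrite -/(y (Z e w)) /x.
move: EY; rewrite !ler_norml (_ : 2 / m%:R = m%:R^-1 + m%:R^-1); last by ring.
by move=> /andP[? ?] /andP[? ?]; apply/andP; split; lra.
Qed.

(** The exceptional set is that of the rounded variables at level delta / 2, whence the 32 = 8 * 4
    in the exponent; the other half of delta absorbs the rounding. *)
Lemma cut_norm_deviation : exists A : set Omega, [/\ measurable A,
  (P A <= (2 * 4 ^+ n * expR (- (delta ^+ 2 / 32) * (n * n)%:R))%:E)%E &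
  forall w, ~ A w -> forall I J : {set 'I_n},
    `|\sum_(i in I) \sum_(j in J) (Y (i, j) w - \int[P]_w Y (i, j) w)| <=
    delta * (n * n)%:R].
Proof.
pose G w : {ffun 'I_n * 'I_n -> 'I_m.+1} := [ffun e => Z e w].
have GE f : G @^-1` [set f] = \bigcap_e (Z e @^-1` [set f e]).
  apply/seteqP; split => [w /= <- e _|w /= Zf]; first by rewrite /= ffunE.
  by apply/ffunP => e; rewrite ffunE; exact: Zf.
have mG f : measurable (G @^-1` [set f]).
  rewrite GE; apply: fin_bigcap_measurable => //.
have PG f : fine (P (G @^-1` [set f])) = \prod_e p e (f e).
  rewrite GE Sg_indep// (_ : (\prod_e _)%E = (\prod_e p e (f e))%:E)//.
  rewrite -prodEFin; apply: eq_bigr => e _.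
  by rewrite /p fineK// fin_num_measure.
pose bad (f : {ffun 'I_n * 'I_n -> 'I_m.+1}) :=
  [exists IJ : {set 'I_n} * {set 'I_n}, delta / 2 * (n * n)%:R <=
     `|\sum_(i in IJ.1) \sum_(j in IJ.2) x (i, j) (f (i, j))|].
have mbad := measurable_finite_preimage mG bad.
exists [set w | bad (G w)]; split => //.
  have -> : P [set w | bad (G w)] = (\sum_(f | bad f) \prod_e p e (f e))%:E.
    have := Rintegral_finite_valued mG (fun f => (bad f)%:R).
    rewrite (@eq_Rintegral _ _ _ _ _ (\1_[set w | bad (G w)])); last first.
      by move=> w _; rewrite indicE; congr ((nat_of_bool _)%:R); apply/idP/idP; rewrite inE.
    rewrite {1}/Rintegral integral_indic// setIT => Pbad.
    rewrite -[LHS]fineK ?fin_num_measure// Pbad; congr EFin.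
    rewrite [RHS]big_mkcond; apply: eq_bigr => f _; rewrite PG.
    by case: ifP => _; rewrite ?mul1r ?mul0r.
  rewrite lee_fin (_ : delta ^+ 2 / 32 = (delta / 2) ^+ 2 / 8); last by field.
  apply: cut_norm_concentration => //.
  by rewrite divr_gt0//= ler_pdivrMr// mul1r (le_trans _ (ler1n R 2))//;
    case/andP: delta01.
move=> w nbad I J; rewrite leNgt; apply/negP => lt; apply: nbad => /=.
apply/existsP; exists (I, J) => /=.
under eq_bigr do under eq_bigr do rewrite ffunE.
set S := \sum_(i in I) _; set S' := \sum_(i in I) _ in lt.
have SS' : `|S' - S| <= 2 / m%:R * (n * n)%:R.
  rewrite -sumrB; apply: (@le_trans _ _ (\sum_(i in I) \sum_(j in J) 2 / m%:R)).
    apply: le_trans (ler_norm_sum _ _ _) _; apply: ler_sum => i _.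
    rewrite -sumrB; apply: le_trans (ler_norm_sum _ _ _) _.
    by apply: ler_sum => j _; exact: ybar_approx.
  rewrite !sumr_const -!mulrnA -[leLHS]mulr_natr ler_wpM2l//.
  rewrite ler_nat mulnC; apply: leq_mul; rewrite -[leqRHS]card_ord; exact: max_card.
have := ler_normD S (S' - S); rewrite addrC subrK => h.
have nn : 0 <= (n * n)%:R :> R by [].
have h2 : 2 / m%:R * (n * n)%:R <= delta / 2 * (n * n)%:R.
  rewrite ler_wpM2r//; have := m_delta; move: (m%:R^-1 : R) => r; lra.
move: h lt SS' h2; lra.
Qed.

End concentration.

(** * Borel-Cantelli in the cut norm *)

Section almost_sure_cut_norm.
Context (R : realType) d (Omega : measurableType d) (P : probability Omega R).

Lemma expR_quadratic_summable (c : R) : 0 < c -> \forall n \near \oo,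
  2 * 4 ^+ n * expR (- c * (n * n)%:R) <= 4 / (2 ^ n.+1)%:R.
Proof.
move=> c0; near=> n.
(* Then exp(-c n) <= 1 / (1 + 7), and 2 * 4^n * 8^(-n) = 4 / 2^(n+1). *)
have cn : 7 <= c * n%:R.
  by rewrite mulrC -ler_pdivrMr//; near: n; exact: nbhs_infty_ger.
have e8 : expR (- (c * n%:R)) <= 8^-1.
  rewrite expRN lef_pV2 ?posrE ?expR_gt0//.
  by apply: le_trans (expR_ge1Dx _); lra.
have -> : expR (- c * (n * n)%:R) = expR (- (c * n%:R)) ^+ n.
  by rewrite -expRM_natl natrM; congr expR; ring.
apply: (@le_trans _ _ (2 * 4 ^+ n * 8^-1 ^+ n)).
  by rewrite ler_wpM2l ?mulr_ge0 ?exprn_ge0// lerXn2r// ?nnegrE ?expR_ge0 ?invr_ge0.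
rewrite -mulrA -exprMn (_ : 4 * 8^-1 = 2^-1 :> R); last by field.
by rewrite natrX exprS exprVn invfM; lra.
Unshelve. all: by end_near. Qed.

Lemma ae_eventually_notin (A : nat -> set Omega) :
  (forall n, measurable (A n)) ->
  (\forall n \near \oo, (P (A n) <= (4 / (2 ^ n.+1)%:R)%:E)%E) ->
  {ae P, forall w, \forall n \near \oo, ~ A n w}.
Proof.
move=> mA [N _ PA].
(* Emptying the first sets makes the geometric bound hold for every index, without changing the
   upper limit. *)
pose A' n := if (N <= n)%N then A n else set0.
have mA' n : measurable (A' n) by rewrite /A'; case: ifP.
have PA' n : (P (A' n) <= (4 / (2 ^ n.+1)%:R)%:E)%E.
  rewrite /A'; case: ifPn => [Nn|_]; first exact: PA.
  by rewrite measure0 lee_fin divr_ge0.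
have sumP : (\sum_(0 <= n <oo) P (A' n) < +oo)%E.
  apply: (@le_lt_trans _ _ 4%:E); last by rewrite ltry.
  apply: le_trans (epsilon_trick0 xpredT _); last by [].
  by apply: lee_nneseries.
exists (lim_sup_set A'); split.
- by apply: bigcap_measurable => // n _; apply: bigcup_measurable.
- exact: lim_sup_set_cvg0.
move=> w /= nAw n _; apply: contrapT => nA'; apply: nAw.
exists (maxn n N) => // k /=; rewrite geq_max => /andP[nk Nk] Akw.
by apply: nA'; exists k => //; rewrite /A' Nk.
Qed.

Variables (Sg : forall n, 'I_n * 'I_n -> set (set Omega)).
Variable Y : forall n, 'I_n * 'I_n -> Omega -> R.
Hypothesis SgD : forall n (e : 'I_n * 'I_n) A B,
  Sg e A -> Sg e B -> Sg e (A `\` B).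
Hypothesis Sg_sub : forall n (e : 'I_n * 'I_n), Sg e `<=` measurable.
Hypothesis Sg_indep : forall n (E : 'I_n * 'I_n -> set Omega),
  (forall e, Sg e (E e)) -> P (\bigcap_e E e) = (\prod_e P (E e))%E.
Hypothesis SgY : forall n (e : 'I_n * 'I_n) r, Sg e [set w | r <= Y e w].
Hypothesis Y01 : forall n (e : 'I_n * 'I_n) w, 0 <= Y e w <= 1.

(** Borel-Cantelli is applied for each tolerance 1 / (k + 1); countably many null sets have a null
    union. *)
Lemma ae_cut_norm_cvg : {ae P, forall w, forall e, 0 < e ->
  \forall n \near \oo, forall I J : {set 'I_n},
    `|\sum_(i in I) \sum_(j in J) (Y (i, j) w - \int[P]_w Y (i, j) w)| <=
    e * (n * n)%:R}.
Proof.
have fixed k : {ae P, forall w, \forall n \near \oo, forall I J : {set 'I_n},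
    `|\sum_(i in I) \sum_(j in J) (Y (i, j) w - \int[P]_w Y (i, j) w)| <=
    k.+1%:R^-1 * (n * n)%:R}.
  have k01 : 0 < (k.+1%:R^-1 : R) <= 1.
    by apply/andP; split; [rewrite invr_gt0 ltr0n|rewrite invf_le1 ?ler1n ?ltr0n].
  have /choice[A AP] : forall n, exists A : set Omega, [/\ measurable A,
      (P A <= (2 * 4 ^+ n *
         expR (- (k.+1%:R^-1 ^+ 2 / 32) * (n * n)%:R))%:E)%E &
      forall w, ~ A w -> forall I J : {set 'I_n},
      `|\sum_(i in I) \sum_(j in J) (Y (i, j) w - \int[P]_w Y (i, j) w)| <=
      k.+1%:R^-1 * (n * n)%:R].
    by move=> n; exact: (@cut_norm_deviation _ _ _ P n (@Sg n) (@Y n) (@SgD n)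
      (@Sg_sub n) (@Sg_indep n) (@SgY n) (@Y01 n) _ k01).
  have mA n : measurable (A n) by have [] := AP n.
  have : \forall n \near \oo, (P (A n) <= (4 / (2 ^ n.+1)%:R)%:E)%E.
    have c0 : 0 < k.+1%:R^-1 ^+ 2 / 32 :> R.
      by rewrite divr_gt0// exprn_gt0//; have /andP[] := k01.
    apply: filterS (expR_quadratic_summable c0) => n ncn.
    by have [_ PA _] := AP n; apply: (le_trans PA); rewrite lee_fin.
  move=> /(ae_eventually_notin mA); apply: filterS => w.
  by apply: filterS => n nA; have [_ _] := AP n; exact.
have := ae_foralln fixed; apply: filterS => w wk e e0.
have [k _ /(_ k (leqnn k)) ke] := near_infty_natSinv_lt (PosNum e0).
apply: filterS (wk k) => n wn I J; apply: le_trans (wn I J) _.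
by rewrite ler_wpM2r// ltW.
Qed.

End almost_sure_cut_norm.

(** * Cadlag Markov chains *)

Section cadlag_measurability.
Context (R : realType) d (Omega : measurableType d).
Variables (T : R) (X : Omega -> R -> bool).
Hypothesis T0 : 0 < T.
Local Notation M := (measurableTypeR R).
Hypothesis mX : forall t, t \in `[0, T] -> measurable [set w | X w t].
Hypothesis cX : forall w, cadlag T (X w).

(** The state space is discrete, so right-continuity means being constant on a short interval to the
    right. *)
Lemma cadlag_right w (s : R) : 0 <= s < T -> exists2 r : R, 0 < r &
  forall u : R, s < u < s + r -> X w u = X w s.
Proof.
move=> sT; have [right _] := cX w.
have /right/(_ [set X w s]) : s \in `[0, T[ by rewrite in_itv.
case.
  by apply: open_nbhs_nbhs; split => //; exact: discrete_open.
move=> r /= r0 rX; exists r => // u /andP[su usr].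
apply: rX => //=; rewrite ltr_distlC; apply/andP; split; lra.
Qed.

Let tau k (s : R) : R :=
  Num.min T ((Num.truncn (k.+1%:R * s)).+1%:R / k.+1%:R).

(** The path is sampled at [tau k s], the first multiple of 1 / (k + 1) strictly after s, capped at
    T. The sampled process is a countable union of rectangles, and right-continuity makes it
    converge; at s = T it already equals the path. *)
Lemma measurable_cadlag : measurable_fun ([set: Omega] `*` (`[0, T] : set M))
  (fun z : Omega * M => (X z.1 z.2)%:R : R).
Proof.
have k0 k : 0 < k.+1%:R :> R by rewrite ltr0n.
pose tj k j : R := Num.min T (j.+1%:R / k.+1%:R).
pose E k : set (Omega * M) := \bigcup_j
  ([set w | X w (tj k j)] `*` `[j%:R / k.+1%:R, j.+1%:R / k.+1%:R[%classic).
have mE k : measurable (E k).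
  apply: bigcup_measurable => j _; apply: measurableX => //; apply: mX.
  by rewrite in_itv/= le_min ltW//= divr_ge0// ge_min lexx.
have EE k w s : s \in `[0, T] -> E k (w, s) <-> X w (tau k s).
  rewrite in_itv/= => /andP[s0 sT].
  have /andP[le lt] := truncn_itv (mulr_ge0 (ltW (k0 k)) s0).
  split=> [[j _ [/= Xj]]|Xs].
    rewrite in_itv/= ler_pdivrMr// ltr_pdivlMr// => /andP[js sj].
    rewrite /tau (_ : Num.truncn _ = j)//; apply: truncn_def.
    by rewrite mulrC js.
  exists (Num.truncn (k.+1%:R * s)) => //; split => //=; rewrite in_itv/=.
  by rewrite ler_pdivrMr// ltr_pdivlMr// (mulrC s) le.
apply: (measurable_fun_cvg (h := fun k => \1_(E k))) => [k|[w s] [_ /= sT]].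
  exact: measurable_indic.
apply: cvg_near_cst.
have indE k : \1_(E k) (w, s) = (X w (tau k s))%:R :> R.
  rewrite indicE; congr ((nat_of_bool _)%:R).
  by apply/idP/idP => [/set_mem /(EE _ _ _ sT)|/(EE _ _ _ sT) /mem_set].
have tau_gt k : s < (Num.truncn (k.+1%:R * s)).+1%:R / k.+1%:R.
  have /andP[s0 _] : 0 <= s <= T by rewrite in_itv in sT.
  have /andP[_ lt] := truncn_itv (mulr_ge0 (ltW (k0 k)) s0).
  by rewrite ltr_pdivlMr// (mulrC s).
have tau_le k : (Num.truncn (k.+1%:R * s)).+1%:R / k.+1%:R <= s + k.+1%:R^-1.
  have /andP[s0 _] : 0 <= s <= T by rewrite in_itv in sT.
  have /andP[le _] := truncn_itv (mulr_ge0 (ltW (k0 k)) s0).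
  by rewrite -natr1 mulrDl mul1r lerD2r ler_pdivrMr// (mulrC s).
move: (sT); rewrite in_itv/= => /andP[s0]; rewrite le_eqVlt => /predU1P[sET|ltsT].
  apply: nearW => k; rewrite indE; congr ((nat_of_bool (X w _))%:R).
  by rewrite /tau -sET min_l// ltW.
have [|r r0 rX] := @cadlag_right w s; first by rewrite s0.
near=> k; rewrite indE; congr ((nat_of_bool _)%:R); apply: rX.
rewrite /tau lt_min ltsT tau_gt/= gt_min.
apply/orP; right; apply: (le_lt_trans (tau_le k)); rewrite ltrD2l.
by near: k; exact: (near_infty_natSinv_lt (PosNum r0)).
Unshelve. all: by end_near. Qed.

End cadlag_measurability.

Section occupation.
Context (R : realType) d (Omega : measurableType d) (P : probability Omega R).
Variables (T : R) (X : Omega -> R -> bool).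
Hypothesis T0 : 0 < T.
Local Notation M := (measurableTypeR R).
Hypothesis mX : forall t, t \in `[0, T] -> measurable [set w | X w t].
Hypothesis cX : forall w, cadlag T (X w).

Definition mean (t : R) : R := \int[P]_w (X w t)%:R.

Lemma meanE t : t \in `[0, T] -> mean t = fine (P [set w | X w t]).
Proof.
move=> tT; rewrite /mean (@eq_Rintegral _ _ _ _ _ (\1_[set w | X w t])).
  by rewrite /Rintegral integral_indic ?setIT//; exact: mX.
by move=> w _; rewrite indicE; congr ((nat_of_bool _)%:R);
  apply/idP/idP => [/mem_set|/set_mem].
Qed.

Lemma mean01 t : t \in `[0, T] -> 0 <= mean t <= 1.
Proof.
move=> tT; rewrite meanE// fine_ge0//=.
rewrite -[leRHS]/(fine 1%:E) fine_le//.
  by rewrite fin_num_measure//; exact: mX.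
by apply: probability_le1; exact: mX.
Qed.

Lemma measurable_path w : measurable_fun (`[0, T] : set M) (fun s => (X w s)%:R : R).
Proof.
apply: (measurable_comp (F := [set: Omega] `*` (`[0, T] : set M))
  (f := fun z : Omega * M => (X z.1 z.2)%:R : R) (g := pair w)).
- exact: measurableX.
- by move=> _ [s sT <-].
- exact: measurable_cadlag.
- exact/measurable_funTS/pair1_measurable.
Qed.

Lemma process_events_sub : process_events X `[0, T] `<=` measurable.
Proof.
apply: smallest_sub; first exact: sigma_algebra_measurable.
by move=> _ [t tT ->]; exact: mX.
Qed.

Lemma process_eventsD A B : process_events X `[0, T] A ->
  process_events X `[0, T] B -> process_events X `[0, T] (A `\` B).
Proof.
pose G := [set E | exists2 t, t \in `[0, T] & E = [set w | X w t]].
exact: (@measurableD _ (g_sigma_algebraType G)).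
Qed.

Variable W : set M.
Hypothesis mW : measurable W.
Hypothesis WT : W `<=` `[0, T].

Let Wfin : (leb1 R W < +oo)%E.
Proof.
apply: (@le_lt_trans _ _ (leb1 R `[0, T]%classic)).
  by apply: le_measure; rewrite ?inE.
by rewrite leb1_itv/= lte_fin T0 -EFinB ltry.
Qed.

(** Joint measurability is applied with Omega carrying the sigma-algebra generated by the chain
    itself: the event must belong to it for independence to be usable. *)
Lemma process_events_occupation (k r : R) : 0 <= k ->
  process_events X `[0, T] [set w | r <= k * \int[leb1 R]_(s in W) (X w s)%:R].
Proof.
pose G := [set E | exists2 t, t \in `[0, T] & E = [set w | X w t]].
pose Om := g_sigma_algebraType G.
have mXO t : t \in `[0, T] -> measurable ([set w | X w t] : set Om).
  by move=> tT; apply: sub_sigma_algebra; exists t.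
have mXW : measurable_fun ([set: Om] `*` W)
    (fun z : Om * M => (X z.1 z.2)%:R : R).
  apply: (measurable_funS (E := [set: Om] `*` (`[0, T] : set M))).
  - exact: measurableX.
  - by move=> [w s] [_ /= /WT].
  - exact: (@measurable_cadlag R _ Om).
have mOW := @measurable_fun_Rintegral_section _ _ Om M R (leb1 R) setT W _
  measurableT mW mXW (fun _ _ => ler0n _ _).
have mkI : measurable_fun [set: Om]
    (fun w => k * \int[leb1 R]_(s in W) (X w s)%:R).
  exact: measurable_funM.
rewrite (_ : [set w | _] = (fun w => k * \int[leb1 R]_(s in W) (X w s)%:R) @^-1`
    `[r, +oo[%classic); last first.
  by apply/seteqP; split => w /=; rewrite in_itv/= andbT.
have := mkI measurableT `[r, +oo[%classic (measurable_itv _).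
by rewrite setTI.
Qed.

Lemma mean_occupation : \int[P]_w \int[leb1 R]_(s in W) (X w s)%:R =
  \int[leb1 R]_(s in W) mean s.
Proof.
pose f (z : Omega * M) : \bar R :=
  ((fun z : Omega * M => ((X z.1 z.2)%:R : R)%:E) \_ ([set: Omega] `*` W)) z.
have mDW : measurable ([set: Omega] `*` W) by exact: measurableX.
have mf : measurable_fun setT f.
  apply/(measurable_restrictT _ mDW)/measurable_EFinP.
  apply: (measurable_funS (E := [set: Omega] `*` (`[0, T] : set M))).
  - exact: measurableX.
  - by move=> [w s] [_ /= /WT].
  - exact: measurable_cadlag.
have f0 z : (0 <= f z)%E by rewrite /f patchE; case: ifP; rewrite ?lee_fin.
have fW w : (\int[leb1 R]_s f (w, s) = \int[leb1 R]_(s in W) ((X w s)%:R : R)%:E)%E.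
  rewrite [RHS]integral_mkcond; apply: eq_integral => s _.
  by rewrite /f patch_section in_setT.
have fP s : (\int[P]_w f (w, s) = if s \in W then \int[P]_w ((X w s)%:R : R)%:E else 0)%E.
  case: ifPn => sW; last first.
    by rewrite integral0_eq// => w _; rewrite /f patch_section in_setT patchE (negPf sW).
  by apply: eq_integral => w _; rewrite /f patch_section in_setT patchE sW.
have eqI : (\int[P]_w \int[leb1 R]_(s in W) ((X w s)%:R : R)%:E =
    \int[leb1 R]_(s in W) \int[P]_w ((X w s)%:R : R)%:E)%E.
  rewrite [RHS]integral_mkcond.
  rewrite -(eq_integral _ _ (fun w _ => fW w)).
  rewrite [LHS](@fubini_tonelli _ _ _ _ R P (leb1 R) f mf f0).
  by apply: eq_integral => s _; rewrite /fubini_G fP patchE.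
rewrite /Rintegral; transitivity
    (fine (\int[P]_w \int[leb1 R]_(s in W) ((X w s)%:R : R)%:E)%E).
  congr fine; apply: eq_integral => w _; rewrite fineK//.
  apply: integrable_fin_num => //.
  apply: (@integrable_bounded _ _ _ _ _ _ 1) => //.
    by apply: measurable_funS (measurable_path w).
  by move=> s _; rewrite normr_nat lern1 leq_b1.
rewrite eqI; congr fine; apply: eq_integral => s sW; rewrite /mean fineK//.
apply: integrable_fin_num => //.
apply: (@integrable_bounded _ _ _ _ _ _ 1) => //.
- by apply: (@le_lt_trans _ _ 1%E); [exact: probability_le1|rewrite ltry].
- rewrite (_ : (fun w => _) = \1_[set w | X w s]).
    by apply: measurable_indic; apply: mX; apply: WT; exact: set_mem.
  apply/funext => w; rewrite indicE; congr ((nat_of_bool _)%:R).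
  by apply/idP/idP => [/mem_set|/set_mem].
- by move=> w _; rewrite normr_nat lern1 leq_b1.
Qed.

End occupation.

(** The Markov property at s = 0 with the sure event identifies the mean with [p 0 t x0 true], the
    start being deterministic. The forward equation closes because the two transition probabilities
    sum to 1. *)
Lemma mean_markov (R : realType) d (Omega : measurableType d)
    (P : probability Omega R) (T : R) x0 up down (X : Omega -> R -> bool) :
  0 < T -> markov_chain P T x0 up down X ->
  measurable_fun (`[0, T] : set (measurableTypeR R)) (mean P X) /\
  forall t, t \in `[0, T] -> mean P X t = x0%:R +
    \int[leb1 R]_(u in `[0, t]) (up u * (1 - mean P X u) - down u * mean P X u).
Proof.
move=> T0 [mX cX X0 [p [p01 mp pE] Xp]].
have meanp t : t \in `[0, T] -> mean P X t = p 0 t x0 true.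
  move=> tT; rewrite (meanE _ mX)//.
  move: (tT); rewrite in_itv/= => /andP[t0 tT'].
  have := Xp 0 t (lexx 0) t0 tT' setT _ x0 true.
  rewrite (_ : [set w | X w 0 = x0] = setT); last first.
    by apply/seteqP; split => // w _; exact: X0.
  rewrite !setTI probability_setT mul1e => -> //.
  rewrite /process_events -[X in _ X]setC0.
  exact: sigma_algebraC (sigma_algebra0 _).
split.
  apply: (eq_measurable_fun (fun t => p 0 t x0 true)).
    by move=> t /set_mem tT; rewrite meanp.
  by apply: mp; rewrite in_itv/= lexx ltW.
move=> t tT; rewrite meanp//; move: (tT); rewrite in_itv/= => /andP[t0 tT'].
rewrite pE// eqb_id; congr (_ + _); apply: eq_Rintegral => u.
rewrite inE/= in_itv/= => /andP[u0 ut].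
have uT : u \in `[0, T] by rewrite in_itv/= u0 (le_trans ut).
have [_ <-] := p01 0 u (lexx 0) u0 (le_trans ut tT') x0.
by rewrite meanp//= addrK mulrC [X in _ - X]mulrC.
Qed.

(** * The limit of the means *)

Section rays.
Context d (Z : measurableType d) (R : realType).
Local Notation M := (measurableTypeR R).

(** A generating class stable under intersection. Its time parts are open left rays or the whole
    line, so they meet a window in an interval, where the integral of a derivative telescopes. *)
Definition ray_products : set (set (Z * M)) :=
  [set E | exists D (b : itv_bound R), [/\ measurable D,
    (b = +oo%O \/ exists x, b = BLeft x) &
    E = D `*` [set` Interval -oo%O b]]].

Lemma setI_closed_ray_products : setI_closed ray_products.
Proof.
move=> _ _ [D [b [mD bE ->]]] [D' [b' [mD' bE' ->]]].
exists (D `&` D'), (Order.min b b'); split; first exact: measurableI.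
  by rewrite /Order.min; case: ifP.
rewrite -setXI; congr (_ `*` _); apply/seteqP; split => x /=;
  rewrite !itv_boundlr/= le_min; [by move=> [-> ->]|by move=> /andP[-> ->]].
Qed.

Lemma ray_products_setT : ray_products setT.
Proof.
exists setT, +oo%O; split; [exact: measurableT|by left|].
by apply/seteqP; split => -[z x].
Qed.

Lemma measurable_ray_products : @measurable _ (Z * M)%type = <<s ray_products >>.
Proof.
rewrite eqEsubset; split; last first.
  apply: smallest_sub; first exact: sigma_algebra_measurable.
  by move=> _ [D [b [mD _ ->]]]; apply: measurableX => //; exact: measurable_itv.
rewrite measurable_prod_measurableType.
apply: smallest_sub; first exact: smallest_sigma_algebra.
move=> _ [D mD [S mS <-]].
pose L := g_sigma_algebraType ray_products.
have mDT : measurable (D `*` setT : set L).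
  apply: sub_sigma_algebra; exists D, +oo%O; split => //; first by left.
  by congr (_ `*` _); apply/seteqP; split => x.
suff : (@measurable _ M) `<=` [set S | measurable (D `*` S : set L)].
  exact.
rewrite [X in X `<=` _]RGenInftyO.measurableE; apply: smallest_sub; last first.
  move=> _ [x ->]; apply: sub_sigma_algebra.
  by exists D, (BLeft x); split => //; right; exists x.
split => /=.
- by rewrite setX0; exact: measurable0.
- move=> A mA; rewrite (_ : D `*` _ = (D `*` setT) `\` (D `*` A)).
    exact: measurableD.
  apply/seteqP; split => -[z x] /=; first by move=> [Dz [_ Ax]]; split => // -[].
  by move=> [[Dz _] nDA]; split => //; split => // Ax; apply: nDA.
- move=> F mF; rewrite setX_bigcupr; exact: bigcupT_measurable.
Qed.

End rays.

Section graph_rates.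
Variables (R : realType) (T : R) (n : nat).
Local Notation M := (measurableTypeR R).
Variable c : 'I_n -> 'I_n -> R -> R.
Hypothesis mc : forall i j, measurable_fun (`[0, T] : set M) (c i j).

Lemma measurable_graph_rate : measurable_fun (cylinder T) (graph_rate c).
Proof.
rewrite /graph_rate /step_kernel.
apply: measurable_sum => i; apply: measurable_sum => j.
apply: measurable_funM.
  apply: (measurable_comp (F := `[0, T]%classic : set M) (f := c i j)
    (g := fun z : M * M * M => z.2)) => //.
    by move=> _ [z [_ zT] <-].
  by apply: measurable_funTS; exact: measurable_snd.
apply: (measurable_comp (F := [set: M * M]) (f := \1_(cell i `*` cell j) : _ -> R)
    (g := fun z : M * M * M => z.1)) => //.
  apply: measurable_indic; apply: measurableX; exact: measurable_cell.
by apply: measurable_funTS; exact: measurable_fst.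
Qed.

Lemma graph_rate_cell xy : (0 < n)%N -> square R xy ->
  exists i j : 'I_n, forall s, (graph_rate c) (xy, s) = c i j s.
Proof.
move=> n0 /(step_kernel_cell n0)[i [j ij]]; exists i, j => s.
by rewrite /graph_rate/= ij.
Qed.

Lemma unit_path_graph_rate :
  (forall i j s, s \in `[0, T] -> 0 <= c i j s <= 1) -> unit_path T (graph_rate c).
Proof.
move=> c01; split=> [|[xy s] [/= sq sT]]; first exact: measurable_graph_rate.
have [n0|n0] := posnP n; last first.
  by have [i [j ->]] := graph_rate_cell n0 sq; exact: c01.
rewrite /graph_rate /step_kernel big1 ?lexx ?ler01// => i.
by have := leq_trans (eq_leq n0) (leq0n i); rewrite leqNgt ltn_ord.
Qed.

Lemma Av_graph_rate eps t xy : (0 < n)%N -> square R xy ->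
  Av T eps (graph_rate c) t xy = step_kernel (fun i j =>
    (fine (leb1 R (window T eps t)))^-1 *
      \int[leb1 R]_(s in window T eps t) c i j s) xy.
Proof.
move=> n0 sq; have [i [j ij]] := step_kernel_cell n0 sq.
rewrite ij /Av; congr (_ * _); apply: eq_Rintegral => s _.
by rewrite /graph_rate/= ij.
Qed.

End graph_rates.

Section flow.
Variables (R : realType) (T eps : R).
Hypotheses (eps0 : 0 < eps) (epsT : eps < T).
Local Notation M := (measurableTypeR R).
Variables (F m : R -> R) (m0 : R).
Hypothesis iF : (leb1 R).-integrable (`[0, T] : set M) (EFin \o F).
Hypothesis mF : forall t, t \in `[0, T] ->
  m t = m0 + \int[leb1 R]_(u in `[0, t]) F u.
Hypothesis m01 : forall t, t \in `[0, T] -> 0 <= m t <= 1.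

Lemma Rintegral_flow (s v : R) : 0 <= s -> s <= v -> v <= T ->
  \int[leb1 R]_(u in `[s, v]) F u = m v - m s.
Proof.
move=> s0 sv vT.
have sub (b c : bool) (x y : R) : 0 <= x -> y <= T ->
    (leb1 R).-integrable ([set` Interval (BSide b x) (BSide c y)] : set M)
      (EFin \o F).
  move=> x0 yT; apply: integrableS iF => // u; apply: subitvP.
  by case: b; case: c; rewrite subitvE !bnd_simp ?x0 ?yT.
rewrite !mF ?in_itv/= ?s0 ?vT ?(le_trans s0) ?(le_trans sv)//.
rewrite opprD addrACA subrr add0r Rintegral_itvB ?bnd_simp//; last exact: sub.
by rewrite Rintegral_itv_obnd_cbnd//; exact: sub.
Qed.

(** The set is empty or an interval, and over an interval the integral is an increment of the
    [0,1]-valued [m]. The bound does not depend on the size of [F], which later contains the factor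
    a(n). *)
Lemma window_ray_flow t (b : itv_bound R) : t \in `[0, T] ->
  b = +oo%O \/ (exists x, b = BLeft x) ->
  `|\int[leb1 R]_(u in window T eps t `&` [set` Interval -oo%O b]) F u| <= 1.
Proof.
move=> tT bE; rewrite windowE.
set l := Num.max _ _; set h := Num.min _ _.
have l0 : 0 <= l by rewrite /l le_max lexx orbT.
have hT : h <= T by rewrite /h ge_min lexx orbT.
have lh : l <= h.
  move: tT eps0 epsT; rewrite in_itv/= /l /h => /andP[? ?] ? ?.
  by case: (leP (t + eps) T); case: (leP (t - eps) 0) => *; lra.
have diff01 (s v : R) : 0 <= s -> s <= v -> v <= T -> `|m v - m s| <= 1.
  move=> s0 sv vT; have /andP[? ?] : 0 <= m v <= 1.
    by apply: m01; rewrite in_itv/= vT (le_trans s0).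
  have /andP[? ?] : 0 <= m s <= 1.
    by apply: m01; rewrite in_itv/= s0 (le_trans sv).
  by rewrite ler_norml; apply/andP; split; lra.
have full : `|\int[leb1 R]_(u in `[l, h]) F u| <= 1.
  by rewrite Rintegral_flow//; exact: diff01.
case: bE => [->|[x ->]].
  rewrite (_ : _ `&` _ = `[l, h]%classic)//.
  by apply/seteqP; split => u /=; [case|rewrite in_itv].
have [xl|lx] := leP x l.
  rewrite (_ : _ `&` _ = set0) ?Rintegral_set0 ?normr0 ?ler01//.
  apply/seteqP; split => u //=; rewrite !in_itv/= => -[/andP[lu _] ux]; lra.
have [xh|hx] := leP x h.
  rewrite (_ : _ `&` _ = `[l, x[%classic).
    rewrite Rintegral_itv_bndo_bndc.
      rewrite Rintegral_flow ?(ltW lx) ?(le_trans xh)//.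
      by apply: diff01; rewrite ?(ltW lx) ?(le_trans xh).
    apply: integrableS iF => // u; apply: subitvP.
    by rewrite subitvE !bnd_simp l0 (le_trans xh).
  apply/seteqP; split => u /=; rewrite !in_itv/=.
    by move=> [/andP[-> _] ->].
  by move=> /andP[-> ux]; rewrite ux (le_trans (ltW ux)).
rewrite (_ : _ `&` _ = `[l, h]%classic)//.
apply/seteqP; split => u /=; rewrite !in_itv/=; first by case.
by move=> /andP[-> uh]; rewrite uh (le_lt_trans uh).
Qed.

End flow.

Section mean_field_limit.
Variables (R : realType) (T eps : R).
Hypotheses (eps0 : 0 < eps) (epsT : eps < T).
Local Notation M := (measurableTypeR R).
Variables (bp bm : R * R * R -> R).
Variables (bnp bnm : forall n : nat, 'I_n -> 'I_n -> R -> R).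
Hypothesis hbp_meas : measurable_fun (cylinder T) bp.
Hypothesis hbm_meas : measurable_fun (cylinder T) bm.
Hypothesis hbp_ge0 : forall z, cylinder T z -> 0 <= bp z.
Hypothesis hbm_ge0 : forall z, cylinder T z -> 0 <= bm z.
Hypothesis hbnp_meas : forall n (i j : 'I_n),
  measurable_fun (`[0, T] : set R) (bnp i j).
Hypothesis hbnm_meas : forall n (i j : 'I_n),
  measurable_fun (`[0, T] : set R) (bnm i j).
Hypothesis hbp_L1 : (leb3 R).-integrable (cylinder T) (EFin \o bp).
Hypothesis hbm_L1 : (leb3 R).-integrable (cylinder T) (EFin \o bm).
Hypothesis hbnp_L1 : forall n, (leb3 R).-integrable (cylinder T)
  (EFin \o graph_rate (@bnp n)).
Hypothesis hbnm_L1 : forall n, (leb3 R).-integrable (cylinder T)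
  (EFin \o graph_rate (@bnm n)).
Hypothesis hbnp_cvg : (\int[leb3 R]_(z in cylinder T)
  `|graph_rate (@bnp n) z - bp z|%:E)%E @[n --> \oo] --> 0%E.
Hypothesis hbnm_cvg : (\int[leb3 R]_(z in cylinder T)
  `|graph_rate (@bnm n) z - bm z|%:E)%E @[n --> \oo] --> 0%E.
Variable c : R.
Hypothesis c0 : 0 < c.
Hypothesis hb_lower : forall n (i j : 'I_n) t, t \in `[0, T] ->
  c <= bnp i j t /\ c <= bnm i j t.
Hypothesis hbn_bounded : \forall n \near \oo, forall i j : 'I_n,
  [bounded bnp i j t | t in `[0, T]] /\ [bounded bnm i j t | t in `[0, T]].
Variable a : nat -> R.
Hypothesis ha_cvg : a n @[n --> \oo] --> +oo.
Variable m : forall n : nat, 'I_n -> 'I_n -> R -> R.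
Variable x0 : forall n : nat, 'I_n -> 'I_n -> R.
Hypothesis m_meas : forall n (i j : 'I_n),
  measurable_fun (`[0, T] : set M) (m i j).
Hypothesis m01 : forall n (i j : 'I_n) t, t \in `[0, T] -> 0 <= m i j t <= 1.
Hypothesis mE : forall n (i j : 'I_n) t, t \in `[0, T] ->
  m i j t = x0 i j + \int[leb1 R]_(u in `[0, t])
    (a n * bnp i j u * (1 - m i j u) - a n * bnm i j u * m i j u).

Let g z := bp z + bm z.
Let Q n := graph_rate (@m n).
Let u n z := equilibrium bp bm z - Q n z.

Let mcyl := measurable_cylinder T.

Let ig : (leb3 R).-integrable (cylinder T) (EFin \o g).
Proof. exact: (integrableD mcyl hbp_L1 hbm_L1). Qed.

Let g_ge0 z : cylinder T z -> 0 <= g z.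
Proof. by move=> zT; rewrite addr_ge0// ?hbp_ge0// hbm_ge0. Qed.

Let Rcvg (f : nat -> R * R * R -> R) :
  (\int[leb3 R]_(z in cylinder T) (f n z)%:E)%E @[n --> \oo] --> 0%E ->
  \int[leb3 R]_(z in cylinder T) f n z @[n --> \oo] --> (0 : R).
Proof. by move=> /fine_cvg. Qed.

Lemma unit_path_equilibrium : unit_path T (equilibrium bp bm).
Proof.
split=> [|z zT].
  apply: (eq_measurable_fun (fun z => bp z * (g z `^ (-1)))).
    by move=> z /set_mem zT; rewrite /equilibrium powR_inv1// g_ge0.
  apply: measurable_funM => //.
  by apply: (measurableT_comp (measurable_powR _)); exact: measurable_funD.
have p0 := hbp_ge0 zT; have q0 := hbm_ge0 zT.
rewrite /equilibrium; move: (bp z) (bm z) p0 q0 => p q p0 q0.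
rewrite divr_ge0 ?addr_ge0//=.
have [pq0|pq0] := eqVneq (p + q) 0; first by rewrite pq0 invr0 mulr0 ler01.
by rewrite ler_pdivrMr ?mul1r ?lerDl// lt_neqAle eq_sym pq0 addr_ge0.
Qed.

Lemma unit_path_mean n : unit_path T (Q n).
Proof. by apply: unit_path_graph_rate; [exact: m_meas|exact: m01]. Qed.

Let measurable_u n : measurable_fun (cylinder T) (u n).
Proof.
by apply: measurable_funB; [exact: unit_path_equilibrium.1|
  exact: (unit_path_mean n).1].
Qed.

Let u_le1 n z : cylinder T z -> `|u n z| <= 1.
Proof.
move=> zT; have /andP[? ?] := unit_path_equilibrium.2 z zT.
have /andP[? ?] := (unit_path_mean n).2 z zT.
by rewrite ler_norml /u; apply/andP; split; lra.
Qed.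

Let N1 n := \int[leb3 R]_(z in cylinder T) `|graph_rate (@bnp n) z - bp z|.
Let N2 n := \int[leb3 R]_(z in cylinder T) `|graph_rate (@bnm n) z - bm z|.

Let iN1 n : (leb3 R).-integrable (cylinder T)
  (EFin \o (fun z => `|graph_rate (@bnp n) z - bp z|)).
Proof. exact: integrable_norm (integrableB mcyl (hbnp_L1 n) hbp_L1). Qed.

Let iN2 n : (leb3 R).-integrable (cylinder T)
  (EFin \o (fun z => `|graph_rate (@bnm n) z - bm z|)).
Proof. exact: integrable_norm (integrableB mcyl (hbnm_L1 n) hbm_L1). Qed.

Let T0 : 0 < T. Proof. exact: lt_trans epsT. Qed.

(** Where [g] vanishes so does [bp], while the approximating rates are at least [c]. Their L^1
    distance thus bounds [c] times the measure of that set, and it tends to 0. *)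
Let g_gt0 : {ae leb3 R, forall z, cylinder T z -> 0 < g z}.
Proof.
have mg : measurable_fun (cylinder T) g by exact: measurable_funD.
pose S := cylinder T `&` g @^-1` `]-oo, 0]%classic.
have mS : measurable S by apply: mg => //; exact: measurable_itv.
have ST : S `<=` cylinder T by exact: subIsetl.
have Sfin := leb3_subcylinder_fin eps0 epsT mS ST.
have S_N1 n : (0 < n)%N -> c * fine (leb3 R S) <= N1 n.
  move=> n0; rewrite -(Rintegral_cst (leb3 R) mS).
  apply: le_trans (ge0_le_Rintegral_subset mS mcyl ST (iN1 n) _) => //.
  apply: le_Rintegral => //.
  - by apply: (@integrable_bounded _ _ _ _ _ _ `|c|).
  - exact: integrableS (iN1 n).
  move=> [xy s] [zT]; rewrite /= in_itv/= /g => g0.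
  have [sq sT] := zT.
  have -> : bp (xy, s) = 0.
    have := hbp_ge0 zT; have := hbm_ge0 zT; lra.
  have [i [j ij]] := step_kernel_cell n0 sq.
  rewrite subr0 (le_trans _ (ler_norm _))// /graph_rate/= ij.
  by have [] := hb_lower i j sT.
exists S; split => //; last first.
  move=> z /= /not_implyP[zT gz]; split => //=; rewrite in_itv/= leNgt.
  exact/negP.
apply/eqP; rewrite eq_le measure_ge0 andbT.
rewrite -[leLHS]fineK ?ge0_fin_numE// lee_fin -(pmulr_rle0 _ c0).
apply: (cvgr_to_ge (Rcvg hbnp_cvg)).
by near=> n; apply: S_N1; near: n; exists 1%N.
Unshelve. all: by end_near. Qed.

Let W t := window T eps t.

(** At a fixed (x, y) the integrand is 1 / a(n) times the derivative of one mean, so its time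
    integral is at most 1 / a(n); then (x, y) ranges over a set of area at most 1. Boundedness of
    the rates makes the derivative integrable. *)
Let inner_flow n (A : set (M * M)) t (b : itv_bound R) : (0 < n)%N ->
  (forall i j : 'I_n, [bounded bnp i j t | t in `[0, T]] /\
                      [bounded bnm i j t | t in `[0, T]]) ->
  0 < a n -> t \in `[0, T] -> measurable A -> A `<=` square R ->
  b = +oo%O \/ (exists x, b = BLeft x) ->
  `|\int[leb3 R]_(z in A `*` (W t `&` [set` Interval -oo%O b]))
    (graph_rate (@bnp n) z * (1 - Q n z) - graph_rate (@bnm n) z * Q n z)| <=
  (a n)^-1.
Proof.
move=> n0 bdd a0 tT mA Asq bE; set J := W t `&` _.
have mJ : measurable (J : set M).
  by apply: measurableI; [exact: measurable_window|exact: measurable_itv].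
have JT : J `<=` `[0, T] by move=> s [] /window_sub.
have AJT : A `*` J `<=` cylinder T by move=> [xy s] [/= /Asq ? /JT ?].
have mAJ : measurable (A `*` J) by exact: measurableX.
pose f z := graph_rate (@bnp n) z * (1 - Q n z) - graph_rate (@bnm n) z * Q n z.
have [mQ Q01] := unit_path_mean n.
have if_ : (leb3 R).-integrable (A `*` J) (EFin \o f).
  have ip : (leb3 R).-integrable (cylinder T)
      (EFin \o (fun z => graph_rate (@bnp n) z * (1 - Q n z))).
    apply: (integrable_mul_le1 mcyl (hbnp_L1 n)).
      by apply: measurable_funB => //; exact: measurable_cst.
    by move=> z /Q01 /andP[? ?]; rewrite ler_norml; apply/andP; split; lra.
  have im : (leb3 R).-integrable (cylinder T)
      (EFin \o (fun z => graph_rate (@bnm n) z * Q n z)).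
    apply: (integrable_mul_le1 mcyl (hbnm_L1 n)) => // z /Q01 /andP[? ?].
    by rewrite ger0_norm.
  exact: (integrableS mcyl mAJ AJT (integrableB mcyl ip im)).
have fub := @Rintegral_fubini _ _ _ _ R (sigma_finite_product (leb1 R) (leb1 R))
  (leb1 R) _ _ f mA mJ if_.
have ifub := @integrable_fubini_setX _ _ _ _ R
  (sigma_finite_product (leb1 R) (leb1 R)) (leb1 R) _ _ _ mA mJ if_.
rewrite [X in `|X|]fub.
have A1 : (leb2 R A <= 1)%E.
  rewrite -(leb2_square R); apply: le_measure; rewrite ?inE//.
  exact: measurable_square.
have Afin : (leb2 R A < +oo)%E by rewrite (le_lt_trans A1)// ltry.
apply: (@le_trans _ _ ((a n)^-1 * fine (leb2 R A))); last first.
  rewrite ler_piMr ?invr_ge0 ?(ltW a0)// -[leRHS]/(fine 1%:E) fine_le//.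
  by rewrite ge0_fin_numE.
apply: normr_Rintegral_le => //.
  by apply: (measurableT_comp (f := fine)) => //; exact: measurable_int ifub.
move=> xy /Asq sq; have [i [j ij]] := step_kernel_cell n0 sq.
pose F s := a n * bnp i j s * (1 - m i j s) - a n * bnm i j s * m i j s.
have iF : (leb1 R).-integrable (`[0, T] : set M) (EFin \o F).
  have mT : measurable (`[0, T]%classic : set M) by exact: measurable_itv.
  have bi (h : R -> R) : measurable_fun (`[0, T] : set M) h ->
      [bounded h t | t in `[0, T]] ->
      (leb1 R).-integrable (`[0, T] : set M) (EFin \o (fun s => a n * h s)).
    move=> mh bh; have : (leb1 R).-integrable (`[0, T] : set M) (EFin \o h).
      apply: measurable_bounded_integrable => //.
      by rewrite leb1_itv/= lte_fin T0 -EFinB ltry.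
    exact: (integrableZl _ (a n)).
  have [bdp bdm] := bdd i j.
  have ip : (leb1 R).-integrable (`[0, T] : set M)
      (EFin \o (fun s => a n * bnp i j s * (1 - m i j s))).
    apply: (integrable_mul_le1 (Z := M) (k := fun s => 1 - m i j s) mT
      (bi _ (hbnp_meas i j) bdp)).
      by apply: measurable_funB => //; exact: measurable_cst.
    move=> s sT; have /andP[? ?] := m01 i j sT.
    by rewrite ler_norml; apply/andP; split; lra.
  have im : (leb1 R).-integrable (`[0, T] : set M)
      (EFin \o (fun s => a n * bnm i j s * m i j s)).
    apply: (integrable_mul_le1 (Z := M) (k := m i j) mT
      (bi _ (hbnm_meas i j) bdm)) => //.
    by move=> s sT; have /andP[? ?] := m01 i j sT; rewrite ger0_norm.
  exact: (integrableB mT ip im).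
have flow := window_ray_flow eps0 epsT iF (mE i j) (m01 i j) tT bE.
have -> : \int[leb1 R]_(s in J) f (xy, s) =
    (a n)^-1 * \int[leb1 R]_(s in J) F s.
  rewrite -RintegralZl//; last exact: integrableS iF.
  apply: eq_Rintegral => s _; rewrite /f /F /graph_rate /Q /graph_rate/= !ij.
  by field; rewrite gt_eqF.
by rewrite normrM ger0_norm ?invr_ge0 ?(ltW a0)// ler_piMr ?invr_ge0 ?(ltW a0).
Qed.

(** Since g w = [bp], also where g = 0 because both rates vanish there, g (w - q^n) is the imbalance
    for the limit rates. It splits into errors of the rates and the imbalance for the n-th rates. *)
Let gu n z : cylinder T z -> g z * u n z =
  ((bp z - graph_rate (@bnp n) z) * (1 - Q n z) -
   (bm z - graph_rate (@bnm n) z) * Q n z) +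
  (graph_rate (@bnp n) z * (1 - Q n z) - graph_rate (@bnm n) z * Q n z).
Proof.
move=> zT; rewrite /u mulrBr.
have -> : g z * equilibrium bp bm z = bp z.
  rewrite /equilibrium /g mulrCA.
  have [pq0|pq0] := eqVneq (bp z + bm z) 0; last by rewrite divff// mulr1.
  rewrite pq0 mul0r mulr0; have := hbp_ge0 zT; have := hbm_ge0 zT.
  by move: pq0; lra.
by rewrite /g; ring.
Qed.

(** The indicator only shrinks the box of integration. By [gu], the L^1 errors of the rates and
    [inner_flow] account for the three terms, none of which depends on A. *)
Let box_bound n (A D : set (M * M)) t (b : itv_bound R) : (0 < n)%N ->
  (forall i j : 'I_n, [bounded bnp i j t | t in `[0, T]] /\
                      [bounded bnm i j t | t in `[0, T]]) ->
  0 < a n -> t \in `[0, T] -> measurable A -> A `<=` square R ->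
  measurable D -> b = +oo%O \/ (exists x, b = BLeft x) ->
  `|\int[leb3 R]_(z in A `*` W t)
    (\1_(D `*` [set` Interval -oo%O b]) z * g z * u n z)| <=
  N1 n + N2 n + (a n)^-1.
Proof.
move=> n0 bdd a0 tT mA Asq mD bE.
pose J := W t `&` [set` Interval -oo%O b].
pose V := (A `&` D) `*` J.
have mJ : measurable (J : set M).
  by apply: measurableI; [exact: measurable_window|exact: measurable_itv].
have mAD : measurable (A `&` D) by exact: measurableI.
have mV : measurable V by exact: measurableX.
have VT : V `<=` cylinder T by move=> [xy s] [[/= /Asq ? _] [/window_sub ?]].
have [mQ Q01] := unit_path_mean n.
pose h1 z := (bp z - graph_rate (@bnp n) z) * (1 - Q n z) -
  (bm z - graph_rate (@bnm n) z) * Q n z.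
pose h2 z := graph_rate (@bnp n) z * (1 - Q n z) - graph_rate (@bnm n) z * Q n z.
have m1Q : measurable_fun (cylinder T) (fun z => 1 - Q n z).
  by apply: measurable_funB => //; exact: measurable_cst.
have Q1 z : cylinder T z -> `|Q n z| <= 1.
  by move=> /Q01 /andP[? ?]; rewrite ger0_norm.
have Q1' z : cylinder T z -> `|1 - Q n z| <= 1.
  by move=> /Q01 /andP[? ?]; rewrite ler_norml; apply/andP; split; lra.
have ih1 : (leb3 R).-integrable (cylinder T) (EFin \o h1).
  exact: (integrableB mcyl
    (integrable_mul_le1 mcyl (integrableB mcyl hbp_L1 (hbnp_L1 n)) m1Q Q1')
    (integrable_mul_le1 mcyl (integrableB mcyl hbm_L1 (hbnm_L1 n)) mQ Q1)).
have ih2 : (leb3 R).-integrable (cylinder T) (EFin \o h2).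
  exact: (integrableB mcyl (integrable_mul_le1 mcyl (hbnp_L1 n) m1Q Q1')
    (integrable_mul_le1 mcyl (hbnm_L1 n) mQ Q1)).
have ih1V := integrableS mcyl mV VT ih1.
have ih2V := integrableS mcyl mV VT ih2.
have -> : \int[leb3 R]_(z in A `*` W t)
    (\1_(D `*` [set` Interval -oo%O b]) z * g z * u n z) =
    \int[leb3 R]_(z in V) h1 z + \int[leb3 R]_(z in V) h2 z.
  rewrite -RintegralD//.
  transitivity (\int[leb3 R]_(z in V) (g z * u n z)); last first.
    by apply: eq_Rintegral => z /set_mem /VT; exact: gu.
  rewrite /V /J setXI [RHS]Rintegral_mkcondr; apply: eq_Rintegral => z _.
  by rewrite patchE indicE -mulrA; case: ifP; rewrite ?mul1r ?mul0r.
apply: le_trans (ler_normD _ _) _; apply: lerD; last first.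
  apply: inner_flow => //; by move=> z [/Asq].
have iN : (leb3 R).-integrable (cylinder T) (EFin \o (fun z =>
    `|graph_rate (@bnp n) z - bp z| + `|graph_rate (@bnm n) z - bm z|)).
  exact: (integrableD mcyl (iN1 n) (iN2 n)).
apply: (@le_trans _ _ (\int[leb3 R]_(z in V)
    (`|graph_rate (@bnp n) z - bp z| + `|graph_rate (@bnm n) z - bm z|))).
  apply: normr_Rintegral_le_dominated => //.
  - by have /measurable_EFinP := measurable_int _ ih1V.
  - exact: integrableS iN.
  - move=> z /VT zT; apply: le_trans (ler_normB _ _) _; rewrite !normrM.
    by apply: lerD; rewrite distrC ler_piMr// ?Q1// Q1'.
rewrite -RintegralD//.
by apply: ge0_le_Rintegral_subset => // z _; rewrite addr_ge0.
Qed.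

(** The admissible cut tests as an index type, so that uniformity over the index is uniformity in
    the cut distance. *)
Let rectangles := {AB : set M * set M | [/\ measurable AB.1, measurable AB.2,
  AB.1 `<=` `[0, 1] & AB.2 `<=` `[0, 1]]}.

Let window_box t (AB : rectangles) : set (M * M * M) :=
  ((sval AB).1 `*` (sval AB).2) `*` W t.

Let measurable_window_box t AB : measurable (window_box t AB).
Proof.
case: AB => -[A B] [/= mA mB A1 B1]; apply: measurableX.
  exact: measurableX.
exact: measurable_window.
Qed.

Let window_box_sub t AB : window_box t AB `<=` cylinder T.
Proof.
case: AB => -[A B] [/= mA mB A1 B1] [xy s] [/= ABxy /window_sub sT].
by split => //; exact: (subset_square A1 B1).
Qed.

Lemma uniformly_null_mean_field t : t \in `[0, T] ->
  uniformly_null (leb3 R) (window_box t) u (fun=> 1).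
Proof.
move=> tT; apply: (@uniformly_null1 _ _ _ (leb3 R) (cylinder T) _ (window_box t) u
  mcyl (measurable_window_box t) (@window_box_sub t) measurable_u u_le1 g ig g_ge0
  _ (@setI_closed_ray_products _ _ R) (@ray_products_setT _ _ R)
  (@measurable_ray_products _ _ R)) => //.
- move=> _ [D [b [mD bE ->]]] e e0.
  have e30 : 0 < e / 3 by rewrite divr_gt0.
  near=> n => AB.
  have N1n : N1 n <= e / 3.
    near: n; have /cvgr_lt := Rcvg hbnp_cvg.
    by move=> /(_ _ e30); apply: filterS => n /ltW.
  have N2n : N2 n <= e / 3.
    near: n; have /cvgr_lt := Rcvg hbnm_cvg.
    by move=> /(_ _ e30); apply: filterS => n /ltW.
  have an : 3 / e <= a n by near: n; have /cvgryPge := ha_cvg; exact.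
  have a0 : 0 < a n by rewrite (lt_le_trans _ an)// divr_gt0.
  have ani : (a n)^-1 <= e / 3.
    by rewrite -[leRHS]invf_div lef_pV2 ?posrE ?divr_gt0.
  case: AB => -[A B] [/= mA mB A1 B1]; rewrite /window_box/=.
  apply: le_trans (box_bound _ _ a0 tT _ _ mD bE) _.
  + by near: n; exists 1%N.
  + by near: n; exact: hbn_bounded.
  + exact: measurableX.
  + exact: subset_square.
  + by move: N1n N2n ani; move: (N1 n) (N2 n) ((a n)^-1) => x y z; lra.
- exact: (leb3_subcylinder_fin eps0 epsT mcyl).
Unshelve. all: by end_near. Qed.

Lemma mean_field_cvg t : t \in `[0, T] -> forall e, 0 < e ->
  \forall n \near \oo, cut_le (Av T eps (Q n) t) (Av T eps (equilibrium bp bm) t) e.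
Proof.
move=> tT e e0; have lpos := window_length eps0 epsT tT.
(* The tolerance [eps * e] pays for the later division by the window length, which is at least
   [eps]. *)
apply: filterS (uniformly_null_mean_field tT (mulr_gt0 eps0 e0)) => n nulln.
move=> A B mA mB A1 B1.
have mAB : measurable (A `*` B) by exact: measurableX.
have ABsq := subset_square A1 B1.
have := nulln (exist _ (A, B) (And4 mA mB A1 B1)); rewrite /window_box/=.
under eq_Rintegral do rewrite mul1r.
have mABW : measurable ((A `*` B) `*` W t).
  by apply: measurableX => //; exact: measurable_window.
have sub : (A `*` B) `*` W t `<=` cylinder T.
  by move=> [xy s] [/= /ABsq ? /window_sub ?].
have uE := unit_path_equilibrium; have uQ := unit_path_mean n.
rewrite RintegralB//; [|exact: (integrable_unit_path eps0 epsT uE)|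
  exact: (integrable_unit_path eps0 epsT uQ)].
rewrite -(Rintegral_Av eps0 epsT uE tT mA mB A1 B1).
rewrite -(Rintegral_Av eps0 epsT uQ tT mA mB A1 B1).
rewrite RintegralB//; last 2 first.
- by apply: integrable_unit_kernel => //; exact: Av_unit_kernel.
- by apply: integrable_unit_kernel => //; exact: Av_unit_kernel.
have l0 := lt_le_trans eps0 lpos.
rewrite -mulrBr normrM (ger0_norm (ltW l0)) distrC.
rewrite -ler_pdivlMl// => /le_trans; apply.
rewrite mulrA; apply: ler_piMl; first exact: ltW.
by rewrite mulrC ler_pdivrMr// mul1r.
Qed.

End mean_field_limit.

(** * Almost sure convergence *)

Section fixed_time.
Variables (R : realType) (T eps : R).
Hypotheses (eps0 : 0 < eps) (epsT : eps < T).
Context d (Omega : measurableType d) (P : probability Omega R).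
Local Notation M := (measurableTypeR R).

Let T0 : 0 < T. Proof. exact: lt_trans epsT. Qed.

Section one_process.
Variable X : Omega -> R -> bool.
Hypothesis mX : forall t, t \in `[0, T] -> measurable [set w | X w t].
Hypothesis cX : forall w, cadlag T (X w).
Variable t : R.
Hypothesis tT : t \in `[0, T].

Let W : set M := window T eps t.
Let l := fine (leb1 R W).

Definition window_average (w : Omega) : R :=
  l^-1 * \int[leb1 R]_(s in W) (X w s)%:R.

Let l0 : 0 < l.
Proof. by apply: (lt_le_trans eps0); exact: window_length. Qed.

Let occupation01 w : 0 <= \int[leb1 R]_(s in W) ((X w s)%:R : R) <= l.
Proof.
apply: (Rintegral_unit_le eps0 epsT) => //.
- exact: measurable_path.
- by move=> s _; rewrite ler0n lern1 leq_b1.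
- exact: measurable_window.
- exact: window_sub.
Qed.

Lemma window_average01 w : 0 <= window_average w <= 1.
Proof.
have /andP[I0 I1] := occupation01 w.
rewrite /window_average mulr_ge0 ?invr_ge0 ?(ltW l0)//=.
by rewrite mulrC ler_pdivrMr// mul1r.
Qed.

Lemma Rintegral_window_average :
  \int[P]_w window_average w = l^-1 * \int[leb1 R]_(s in W) mean P X s.
Proof.
have mW : measurable W by exact: measurable_window.
have WT : W `<=` `[0, T] by exact: window_sub.
rewrite -(mean_occupation P T0 mX cX mW WT) RintegralZl//.
apply: (@integrable_bounded _ _ _ _ _ _ l) => //.
- by apply: (@le_lt_trans _ _ 1%E); [exact: probability_le1|rewrite ltry].
- have mXW : measurable_fun ([set: Omega] `*` W)
      (fun z : Omega * M => (X z.1 z.2)%:R : R).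
    apply: (measurable_funS (E := [set: Omega] `*` (`[0, T] : set M))).
    + exact: measurableX.
    + by move=> [w s] [_ /= /WT].
    + exact: measurable_cadlag.
  exact: (@measurable_fun_Rintegral_section _ _ Omega M R (leb1 R) setT W _
    measurableT mW mXW (fun _ _ => ler0n _ _)).
- by move=> w _; have /andP[? ?] := occupation01 w; rewrite ger0_norm.
Qed.

End one_process.

Variable X : forall n : nat, 'I_n -> 'I_n -> Omega -> R -> bool.
Hypothesis mX : forall n (i j : 'I_n) t, t \in `[0, T] ->
  measurable [set w | X i j w t].
Hypothesis cX : forall n (i j : 'I_n) w, cadlag T (X i j w).
Hypothesis X_indep : forall n,
  independent_processes P T (fun ij : 'I_n * 'I_n => X ij.1 ij.2).

Lemma unit_path_graph_process n w : unit_path T (graph_process (@X n) w).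
Proof.
apply: (@unit_path_graph_rate R T n (fun i j s => (X i j w s)%:R)).
  move=> i j; apply: (measurable_path T0) => [t tT|v]; [exact: mX|exact: cX].
by move=> i j s _; rewrite ler0n lern1 leq_b1.
Qed.

(** On the square both averages are step kernels, with the window averages of the chains and their
    expectations as coefficients. Each window average depends on one chain only, so the independent
    concentration bound applies. *)
Lemma ae_cut_le_mean (t : R) : t \in `[0, T] ->
  {ae P, forall w, forall e, 0 < e -> \forall n \near \oo,
    cut_le (Av T eps (graph_process (@X n) w) t)
      (Av T eps (graph_rate (fun i j => mean P (@X n i j))) t) e}.
Proof.
move=> tT; pose Y n (ij : 'I_n * 'I_n) := window_average (X ij.1 ij.2) t.
pose Sg n (ij : 'I_n * 'I_n) := process_events (X ij.1 ij.2) `[0, T].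
have YE n (ij : 'I_n * 'I_n) := Rintegral_window_average
  (@mX n ij.1 ij.2) (@cX n ij.1 ij.2) t.
have := @ae_cut_norm_cvg R d Omega P Sg Y.
have SgD n (e : 'I_n * 'I_n) A B : Sg n e A -> Sg n e B -> Sg n e (A `\` B).
  exact: process_eventsD.
have Sgs n (e : 'I_n * 'I_n) : Sg n e `<=` measurable.
  by apply: process_events_sub => s; exact: mX.
have Sgi n (E : 'I_n * 'I_n -> set Omega) : (forall e, Sg n e (E e)) ->
    P (\bigcap_e E e) = (\prod_e P (E e))%E.
  move=> SE; have := @X_indep n [set: 'I_n * 'I_n]%SET E (fun e _ => SE e).
  rewrite (_ : [set` _] = setT); last first.
    by apply/seteqP; split => e //= _; rewrite inE.
  by move=> ->; apply: eq_bigl => e; rewrite inE.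
have SgY n (e : 'I_n * 'I_n) r : Sg n e [set w | r <= Y n e w].
  apply: (process_events_occupation T0) => //.
    exact: measurable_window.
  exact: window_sub.
have Y01 n (e : 'I_n * 'I_n) w : 0 <= Y n e w <= 1.
  by apply: window_average01 => // s; exact: mX.
move=> /(_ SgD Sgs Sgi SgY Y01); apply: filterS => w wY e e0.
have npos : \forall n \near \oo, (0 < n)%N by exists 1%N.
apply: filterS2 npos (wY e e0) => n n0 IJn A B mA mB A1 B1.
have ABsq := subset_square A1 B1.
have step := @cut_le_step_kernel R n (fun i j => Y n (i, j) w)
  (fun i j => \int[P]_w Y n (i, j) w) e n0 IJn A B mA mB A1 B1.
apply: le_trans step; rewrite le_eqVlt; apply/orP; left; apply/eqP.
congr `|_|; apply: eq_Rintegral => xy /set_mem /ABsq sq.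
have AH := @Av_graph_rate R T n (fun i j s => (X i j w s)%:R) eps t xy n0 sq.
have AQ := @Av_graph_rate R T n (fun i j => mean P (X i j)) eps t xy n0 sq.
rewrite [X in X - _]AH AQ; congr (_ - _).
by congr step_kernel; apply/funext => i; apply/funext => j; rewrite YE.
Qed.

End fixed_time.

(** * From grids of times to uniform convergence *)

Lemma cut_le_ext (R : realType) (f g : R * R -> R) (e1 e2 : R) : e1 <= e2 ->
  cut_le f g e1 -> cut_le f g e2.
Proof.
by move=> e12 fg A B mA mB A1 B1; exact: le_trans (fg A B mA mB A1 B1) e12.
Qed.

(** Both averaged paths have Lipschitz constant 4 / eps, uniformly in n, so moving to the nearby
    grid time and back costs little once the mesh T / (K + 1) is small. *)
Lemma unif_cvg_of_grid (R : realType) (T eps : R) (phi : nat -> R * R * R -> R)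
    (psi : R * R * R -> R) : 0 < eps -> eps < T ->
  (forall n, unit_path T (phi n)) -> unit_path T psi ->
  (forall K j : nat, forall e, 0 < e -> \forall n \near \oo,
    let t := Num.min T (j%:R * (T / K.+1%:R)) in
    cut_le (Av T eps (phi n) t) (Av T eps psi t) e) ->
  unif_cvg (@cut_metric R) T (fun n t => hat (Av T eps (phi n) t))
    (fun t => hat (Av T eps psi t)).
Proof.
move=> eps0 epsT uphi upsi grid e e0; have T0 := lt_trans eps0 epsT.
(* With 1 / (K + 1) < e eps / (32 T), each move to the grid costs at most e / 8; with e / 4 at the
   grid point the total is e / 2. *)
have [K _ /(_ K (leqnn K)) Ke] :=
  near_infty_natSinv_lt (PosNum (divr_gt0 (mulr_gt0 e0 eps0) (mulr_gt0 (ltr0n R 32) T0))).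
have K0 : 0 < K.+1%:R :> R by rewrite ltr0n.
pose tj (j : nat) : R := Num.min T (j%:R * (T / K.+1%:R)).
have tjT j : tj j \in `[0, T].
  rewrite in_itv/= ge_min lexx/= andbT le_min ltW//=.
  by rewrite mulr_ge0// divr_ge0// ltW.
have e40 : 0 < e / 4 by rewrite divr_gt0.
have : \forall n \near \oo, forall j : 'I_K.+2,
    cut_le (Av T eps (phi n) (tj j)) (Av T eps psi (tj j)) (e / 4).
  by apply: filter_forall => j; exact: grid.
apply: filterS => n gridn t tT; move: (tT); rewrite in_itv/= => /andP[t0 t1].
have [j tjt] : exists j : 'I_K.+2, `|t - tj j| <= T / K.+1%:R.
  have h0 : 0 < T / K.+1%:R by rewrite divr_gt0.
  have /andP[le lt] := truncn_itv (divr_ge0 t0 (ltW h0)).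
  have jK : (Num.truncn (t / (T / K.+1%:R)) < K.+2)%N.
    rewrite ltnS -(ler_nat R) (le_trans le)// ler_pdivrMr//.
    by rewrite mulrC divfK// gt_eqF.
  exists (Ordinal jK); move: le lt; set N := Num.truncn _; rewrite /tj/= ler_pdivlMr// ltr_pdivrMr//.
  rewrite -[N.+1%:R]natr1 mulrDl mul1r => le lt.
  rewrite min_r ?(le_trans le)// ger0_norm ?subr_ge0//.
  by rewrite lerBlDl ltW.
have lip : 4 / eps * `|t - tj j| <= e / 8.
  apply: (@le_trans _ _ (4 / eps * (T / K.+1%:R))).
    by rewrite ler_wpM2l// divr_ge0// ltW.
  have : 4 / eps * (T * K.+1%:R^-1) <= 4 / eps * (T * (e * eps / (32 * T))).
    by rewrite !ler_wpM2l ?divr_ge0 ?(ltW eps0) ?(ltW T0)// ltW.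
  move=> /le_trans; apply; rewrite le_eqVlt; apply/orP; left; apply/eqP.
  by field; rewrite !gt_eqF.
have U f : unit_path T f -> forall s, s \in `[0, T] -> unit_kernel (Av T eps f s).
  by move=> uf s sT; exact: Av_unit_kernel.
apply: (@le_lt_trans _ _ (e / 8 + e / 4 + e / 8)); last by lra.
apply: cut_metric_hat_le; [exact/unit_kernel_S0/U|exact/unit_kernel_S0/U|].
apply: (@cut_le_trans _ _ (Av T eps psi (tj j))); [exact: U..| |].
  apply: (@cut_le_trans _ _ (Av T eps (phi n) (tj j))); [exact: U..| |exact: gridn].
  by apply: cut_le_ext lip _; exact: cut_le_Av.
by apply: cut_le_ext lip _; rewrite distrC; exact: cut_le_Av.
Qed.

Theorem proposition3p14
  (R : realType) (d : measure_display) (Omega : measurableType d)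
  (P : probability Omega R)
  (T : R) (hT : 0 < T)
  (bp bm : R * R * R -> R)
  (bnp bnm : forall n : nat, 'I_n -> 'I_n -> R -> R)
  (hbp_meas : measurable_fun (cylinder T) bp)
  (hbm_meas : measurable_fun (cylinder T) bm)
  (hbp_ge0 : forall z, cylinder T z -> 0 <= bp z)
  (hbm_ge0 : forall z, cylinder T z -> 0 <= bm z)
  (hbnp_meas : forall n (i j : 'I_n),
     measurable_fun (`[0, T] : set R) (bnp n i j))
  (hbnm_meas : forall n (i j : 'I_n),
     measurable_fun (`[0, T] : set R) (bnm n i j))
  (hbnp_ge0 : forall n (i j : 'I_n) t, t \in `[0, T] -> 0 <= bnp n i j t)
  (hbnm_ge0 : forall n (i j : 'I_n) t, t \in `[0, T] -> 0 <= bnm n i j t)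
  (* (a) *)
  (hbp_L1 : (leb3 R).-integrable (cylinder T) (EFin \o bp))
  (hbm_L1 : (leb3 R).-integrable (cylinder T) (EFin \o bm))
  (hbnp_L1 : forall n, (leb3 R).-integrable (cylinder T)
     (EFin \o graph_rate (bnp n)))
  (hbnm_L1 : forall n, (leb3 R).-integrable (cylinder T)
     (EFin \o graph_rate (bnm n)))
  (hbnp_cvg : (\int[leb3 R]_(z in cylinder T)
     `|graph_rate (bnp n) z - bp z|%:E)%E @[n --> \oo] --> 0%E)
  (hbnm_cvg : (\int[leb3 R]_(z in cylinder T)
     `|graph_rate (bnm n) z - bm z|%:E)%E @[n --> \oo] --> 0%E)
  (* (b) *)
  (hb_lower : exists2 c : R, 0 < c &
     forall n (i j : 'I_n) t, t \in `[0, T] ->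
       c <= bnp n i j t /\ c <= bnm n i j t)
  (* (c) *)
  (hb_left : {ae leb2 R, forall xy, square R xy ->
     bounded_left_cont T (fun t => bp (xy, t)) /\
     bounded_left_cont T (fun t => bm (xy, t))})
  (hbn_left : \forall n \near \oo, forall i j : 'I_n,
     bounded_left_cont T (bnp n i j) /\ bounded_left_cont T (bnm n i j))
  (a : nat -> R)
  (ha_gt0 : forall n, (0 < n)%N -> 0 < a n)
  (ha_cvg : a n @[n --> \oo] --> +oo)
  (x0 : forall n : nat, 'I_n -> 'I_n -> bool)
  (X : forall n : nat, 'I_n -> 'I_n -> Omega -> R -> bool)
  (hX_markov : forall n (i j : 'I_n),
     markov_chain P T (x0 n i j)
       (fun t => a n * bnp n i j t) (fun t => a n * bnm n i j t) (X n i j))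
  (hX_indep : forall n,
     independent_processes P T (fun ij : 'I_n * 'I_n => X n ij.1 ij.2))
  (eps : R) (heps : 0 < eps < T) :
  let A n w t := hat (Av T eps (graph_process (X n) w) t) in
  let w_eps t := hat (Av T eps (equilibrium bp bm) t) in
  [/\ forall n w, (0 < n)%N -> C_paths (@S0hat R) (@cut_metric R) T (A n w),
      C_paths (@S0hat R) (@cut_metric R) T w_eps &
      {ae P, forall w, unif_cvg (@cut_metric R) T (fun n => A n w) w_eps}].

Proof.
move=> A w_eps; have /andP[eps0 epsT] := heps.
have mX n (i j : 'I_n) t : t \in `[0, T] -> measurable [set w | X n i j w t].
  by have [H _ _ _] := hX_markov n i j; exact: H.
have cX n (i j : 'I_n) w : cadlag T (X n i j w).
  by have [_ H _ _] := hX_markov n i j; exact: H.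
have uH n w : unit_path T (graph_process (X n) w).
  exact: (unit_path_graph_process eps0 epsT mX cX).
have uE := unit_path_equilibrium hbp_meas hbm_meas hbp_ge0 hbm_ge0.
split=> [n w _||]; try exact: C_paths_Av.
have [c c0 hc] := hb_lower.
pose m n (i j : 'I_n) := mean P (X n i j).
have mm n (i j : 'I_n) := mean_markov hT (hX_markov n i j).
have m01 n (i j : 'I_n) t : t \in `[0, T] -> 0 <= m n i j t <= 1.
  by move=> tT; apply: (mean01 P (mX n i j)).
(* Half of [e] goes to the fluctuation around the mean, half to the distance of the mean from the
   equilibrium. *)
have fixed_time (t : R) : t \in `[0, T] -> {ae P, forall w, forall e, 0 < e ->
    \forall n \near \oo, cut_le (Av T eps (graph_process (X n) w) t)
      (Av T eps (equilibrium bp bm) t) e}.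
  move=> tT; have := ae_cut_le_mean eps0 epsT mX cX hX_indep tT.
  apply: filterS => w cvg_mean e e0; have e20 : 0 < e / 2 by rewrite divr_gt0.
  have bounded : \forall n \near \oo, forall i j : 'I_n,
      [bounded bnp n i j t | t in `[0, T]] /\ [bounded bnm n i j t | t in `[0, T]].
    apply: filterS hbn_left => n bl i j.
    by have [[bdp _] [bdm _]] := bl i j.
  have mean_cvg := @mean_field_cvg R T eps eps0 epsT bp bm bnp bnm
    hbp_meas hbm_meas hbp_ge0 hbm_ge0 hbnp_meas hbnm_meas hbp_L1 hbm_L1
    hbnp_L1 hbnm_L1 hbnp_cvg hbnm_cvg c c0 hc bounded a ha_cvg m
    (fun n i j => (x0 n i j)%:R) (fun n i j => (mm n i j).1) m01
    (fun n i j => (mm n i j).2) t tT (e / 2) e20.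
  apply: filterS2 (cvg_mean _ e20) mean_cvg => n H1 H2.
  rewrite (splitr e); apply: cut_le_trans H1 H2; apply: Av_unit_kernel => //.
  by apply: unit_path_graph_rate => i j; [exact: (mm n i j).1|exact: m01].
(* The points of all grids are countably many, so one null set serves them all. *)
have grid : {ae P, forall w, forall K j : nat, forall e, 0 < e ->
    \forall n \near \oo, let t := Num.min T (j%:R * (T / K.+1%:R)) in
    cut_le (Av T eps (graph_process (X n) w) t)
      (Av T eps (equilibrium bp bm) t) e}.
  apply: ae_foralln => K; apply: ae_foralln => j; apply: fixed_time.
  rewrite in_itv/= ge_min lexx/= andbT le_min ltW//=.
  by rewrite mulr_ge0// divr_ge0// ltW.
by apply: filterS grid => w gridw; exact: unif_cvg_of_grid.
Qed.
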